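(* Let $\mathbb{G}$ be a finite quantum group and let $\nu\in M_p(\mathbb{G})$ be a state on $F(\mathbb{G})$. The random walk on $\mathbb{G}$ given by $\nu$ is ergodic if and only if $\nu$ is not supported on a proper quasi-subgroup and $\nu$ is not supported on a cyclic coset of a proper quasi-subgroup.
   Context: A finite quantum group $\mathbb{G}$ is given by its algebra of functions $F(\mathbb{G})$: a finite-dimensional unital $\mathrm{C}^*$-algebra with a $*$-homomorphism (comultiplication) $\Delta:F(\mathbb{G})\to F(\mathbb{G})\otimes F(\mathbb{G})$, a counit $\varepsilon$ and an antipode $S$ making $(F(\mathbb{G}),\Delta,S,\varepsilon)$ a Hopf $*$-algebra. Its unit is $\mathds{1}_{\mathbb{G}}$. $2^{\mathbb{G}}$ denotes the set of projections ($p=p^*=p^2$) in $F(\mathbb{G})$, and $M_p(\mathbb{G})$ the set of states (positive linear functionals $\mu$ with $\mu(\mathds{1}_{\mathbb{G}})=1$) on $F(\mathbb{G})$. A random walk on $\mathbb{G}$ is given by a state $\nu\in M_p(\mathbb{G})$. The convolution of states is $\mu\star\nu:=(\mu\otimes\nu)\Delta$, and the convolution powers are $\nu^{\star 1}=\nu$, $\nu^{\star(k+1)}=(\nu\otimes\nu^{\star k})\circ\Delta$. The Haar state $\int_{\mathbb{G}}$ is the unique state $\pi$ with $\pi\star\mu=\pi=\mu\star\pi$ for all $\mu\in M_p(\mathbb{G})$. The random walk given by $\nu$ is ergodic if $(\nu^{\star k})_{k\ge1}$ converges to the Haar state. The stochastic operator of $\nu$ is $T_\nu:=(\nu\otimes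 I_{F(\mathbb{G})})\circ\Delta:F(\mathbb{G})\to F(\mathbb{G})$. A group-like projection is a non-zero $p\in 2^{\mathbb{G}}$ with $\Delta(p)(\mathds{1}_{\mathbb{G}}\otimes p)=p\otimes p$. To a group-like projection one associates a (virtual) quasi-subgroup $\mathbb{S}\subseteq\mathbb{G}$ and writes the projection as $\mathds{1}_{\mathbb{S}}$; $\mathbb{S}$ is proper if $\mathds{1}_{\mathbb{S}}\neq\mathds{1}_{\mathbb{G}}$. A state $\nu$ is supported on a quasi-subgroup $\mathbb{S}$ if $\nu(\mathds{1}_{\mathbb{S}})=1$. A state $\nu$ is supported on a cyclic coset of a proper quasi-subgroup if there exist projections $p_0,p_1\in2^{\mathbb{G}}$ such that $p_0p_1=0$, $p_0+p_1\le\mathds{1}_{\mathbb{G}}$, $\nu(p_1)=1$, $p_0$ is a group-like projection, $T_\nu(p_1)=p_0$, and there exists an integer $d>1$ such that $T_\nu^d(p_1)=p_1$. *)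

(* Defs.v *)
From HB Require Import structures.
From mathcomp Require Import all_boot all_order all_algebra all_field.
From mathcomp Require Import complex.
From mathcomp Require Import all_classical all_reals all_analysis.

Set Implicit Arguments.
Unset Strict Implicit.
Unset Printing Implicit Defensive.

Import Order.TTheory GRing.Theory Num.Theory.
Import VectorInternalTheory.
Import numFieldNormedType.Exports.

Local Open Scope ring_scope.
Local Open Scope complex_scope.
Local Open Scope classical_set_scope.

(* A finite-dimensional tensor product U ⊗ V, modelled by the matrices of
   coordinates in the basis (vbase i ⊗ vbase j); [tliftE] and [tens_ext] are
   its universal property. *)
Definition tensor (K : fieldType) (U V : vectType K) : Type :=
  'M[K]_(dim U, dim V).

HB.instance Definition _ (K : fieldType) (U V : vectType K) :=
  Vector.copy (tensor U V) 'M[K]_(dim U, dim V).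

Definition vbase (K : fieldType) (U : vectType K) (i : 'I_(dim U)) : U :=
  r2v (delta_mx 0 i).

Definition tcoef (K : fieldType) (U V : vectType K) (t : tensor U V)
  (i : 'I_(dim U)) (j : 'I_(dim V)) : K := fun_of_matrix t i j.

Definition tens (K : fieldType) (U V : vectType K) (u : U) (v : V) :
    tensor U V :=
  \matrix_(i, j) (v2r u 0 i * v2r v 0 j).

Notation "u ⊗ v" := (tens u v) (at level 40, left associativity) : ring_scope.

Section TensorVect.
Variables (K : fieldType).
Implicit Types U V W : vectType K.

Lemma vbaseE U (u : U) : u = \sum_i v2r u 0 i *: vbase i.
Proof.
rewrite -[LHS]v2rK [v2r u in LHS]row_sum_delta raddf_sum /=.
by apply: eq_bigr => i _; rewrite linearZ.
Qed.

Lemma v2r_vbase U (i k : 'I_(dim U)) : v2r (vbase i) 0 k = (k == i)%:R.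
Proof. by rewrite /vbase r2vK mxE eqxx. Qed.

Lemma tcoefE U V (u : U) (v : V) i j :
  tcoef (u ⊗ v) i j = v2r u 0 i * v2r v 0 j.
Proof. by rewrite /tcoef mxE. Qed.

Lemma tcoefP U V (s t : tensor U V) : tcoef s =2 tcoef t -> s = t.
Proof. by move=> h; apply/matrixP. Qed.

Lemma tcoef_is_linear U V (i : 'I_(dim U)) (j : 'I_(dim V)) c
  (s t : tensor U V) :
  tcoef (c *: s + t) i j = c * tcoef s i j + tcoef t i j.
Proof. by rewrite /tcoef /= !mxE. Qed.

Lemma tens_linearl U V (v : V) : linear (fun u : U => u ⊗ v).
Proof.
move=> c u u'; apply: tcoefP => i j.
by rewrite tcoef_is_linear !tcoefE linearP !mxE mulrDl mulrA.
Qed.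

Lemma tens_linearr U V (u : U) : linear (fun v : V => u ⊗ v).
Proof.
move=> c v v'; apply: tcoefP => i j.
by rewrite tcoef_is_linear !tcoefE linearP !mxE mulrDr mulrCA.
Qed.

Definition bilin U V W (b : U -> V -> W) :=
  (forall v, linear (b^~ v)) /\ (forall u, linear (b u)).

Lemma tens_bilin U V : bilin (@tens K U V).
Proof. by split => [v|u]; [apply: tens_linearl|apply: tens_linearr]. Qed.

(* The linear map on U ⊗ V induced by a bilinear b. *)
Definition tlift U V W (b : U -> V -> W) (t : tensor U V) : W :=
  \sum_i \sum_j tcoef t i j *: b (vbase i) (vbase j).

Lemma tlift_is_linear U V W (b : U -> V -> W) : linear (tlift b).
Proof.
move=> c s t; rewrite /tlift scaler_sumr -big_split /=; apply: eq_bigr => i _.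
rewrite scaler_sumr -big_split /=; apply: eq_bigr => j _.
by rewrite tcoef_is_linear scalerDl scalerA.
Qed.

HB.instance Definition _ U V W (b : U -> V -> W) :=
  GRing.isLinear.Build K (tensor U V) W _ (tlift b) (tlift_is_linear b).

Lemma linear_scale_fun U W (f : U -> W) (a : K) (x : U) :
  linear f -> f (a *: x) = a *: f x.
Proof.
move=> lf.
have f0 : f 0 = 0.
  apply: (addrI (f 0)).
  by have := lf 1 0 0; rewrite !scale1r !addr0 => <-.
by have := lf a x 0; rewrite f0 !addr0.
Qed.

Lemma linear_sum_fun U W (f : U -> W) (I : finType) (c : I -> K) (u : I -> U) :
  linear f -> f (\sum_i c i *: u i) = \sum_i c i *: f (u i).
Proof.
move=> lf.
have fD : {morph f : x y / x + y}.
  by move=> x y; have := lf 1 x y; rewrite !scale1r.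
have f0 : f 0 = 0 by apply: (addrI (f 0)); rewrite -fD !addr0.
by rewrite (big_morph f fD f0); apply: eq_bigr => i _; rewrite linear_scale_fun.
Qed.

Lemma tliftE U V W (b : U -> V -> W) u v : bilin b -> tlift b (u ⊗ v) = b u v.
Proof.
case=> bl br; rewrite [in RHS](vbaseE u) (@linear_sum_fun _ _ (b^~ v)) //.
apply: eq_bigr => i _; rewrite [in RHS](vbaseE v) linear_sum_fun //.
rewrite scaler_sumr; apply: eq_bigr => j _.
by rewrite tcoefE scalerA.
Qed.

Lemma tensE U V (t : tensor U V) : t = tlift (@tens K U V) t.
Proof.
apply: tcoefP => i j; rewrite /tlift /tcoef.
rewrite summxE (bigD1 i) //= summxE (bigD1 j) //= !mxE !v2r_vbase !eqxx !mulr1.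
rewrite big1 => [|k /negPf kj]; last first.
  by rewrite !mxE !v2r_vbase [j == k]eq_sym kj !mulr0.
rewrite addr0 big1 ?addr0 // => k /negPf ki.
rewrite summxE big1 // => l _.
by rewrite !mxE !v2r_vbase [i == k]eq_sym ki mul0r mulr0.
Qed.

Lemma tens_ext U V W (f g : tensor U V -> W) : linear f -> linear g ->
  (forall u v, f (u ⊗ v) = g (u ⊗ v)) -> f =1 g.
Proof.
move=> lf lg fg t.
have dbl (h : tensor U V -> W) : linear h ->
    h t = \sum_i \sum_j tcoef t i j *: h (vbase i ⊗ vbase j).
  move=> lh; rewrite [in LHS](tensE t) /tlift.
  have := linear_sum_fun (fun=> 1) (fun i => \sum_j
    tcoef t i j *: (vbase i ⊗ vbase j)) lh.
  under eq_bigr do rewrite scale1r.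
  move=> ->; apply: eq_bigr => i _.
  by rewrite scale1r linear_sum_fun.
rewrite (dbl f) // (dbl g) //; apply: eq_bigr => i _.
by apply: eq_bigr => j _; rewrite fg.
Qed.

Definition tmap U V U' V' (f : U -> U') (g : V -> V') :
    tensor U V -> tensor U' V' :=
  tlift (fun u v => f u ⊗ g v).

Definition tassoc U V W : tensor (tensor U V) W -> tensor U (tensor V W) :=
  tlift (fun t w => tlift (fun u v => u ⊗ (v ⊗ w)) t).

Lemma tassocE U V W (u : U) (v : V) (w : W) :
  tassoc (u ⊗ v ⊗ w) = u ⊗ (v ⊗ w).
Proof.
have h x : bilin (fun (u : U) (v : V) => u ⊗ (v ⊗ x)).
  split=> [y|y] c a b; first by rewrite tens_linearl.
  by rewrite tens_linearl tens_linearr.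
rewrite /tassoc tliftE ?tliftE //; split=> [y|t]; first exact: tlift_is_linear.
move=> c a b; move: t; apply: tens_ext.
- exact: tlift_is_linear.
- move=> d s t; rewrite !(tlift_is_linear _ _ s).
  by rewrite !scalerDr addrACA !scalerA mulrC.
- by move=> x y; rewrite !tliftE // !tens_linearr.
Qed.

End TensorVect.

Section TensorAlg.
Variables (K : fieldType) (A B : falgType K).
Implicit Types (s t : tensor A B).

Definition tone : tensor A B := 1 ⊗ 1.

Definition tmul s t : tensor A B :=
  tlift (fun a b => tlift (fun a' b' => (a * a') ⊗ (b * b')) t) s.

Let mul_bilin a b : bilin (fun a' b' => (a * a') ⊗ (b * b') : tensor A B).
Proof.
split=> [y|y] c u v.
  by rewrite mulrDr -scalerAr tens_linearl.
by rewrite mulrDr -scalerAr tens_linearr.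
Qed.

Let tmul_bilin t :
  bilin (fun a b => tlift (fun a' b' => (a * a') ⊗ (b * b')) t : tensor A B).
Proof.
split=> [y|y] c u v; move: t; apply: tens_ext; try exact: tlift_is_linear.
- move=> d s t; rewrite !(tlift_is_linear _ _ s).
  by rewrite !scalerDr addrACA !scalerA mulrC.
- by move=> a b; rewrite !tliftE // mulrDl -scalerAl tens_linearl.
- move=> d s t; rewrite !(tlift_is_linear _ _ s).
  by rewrite !scalerDr addrACA !scalerA mulrC.
- by move=> a b; rewrite !tliftE // mulrDl -scalerAl tens_linearr.
Qed.

Lemma tmulE (a a' : A) (b b' : B) :
  tmul (a ⊗ b) (a' ⊗ b') = (a * a') ⊗ (b * b').
Proof. by rewrite /tmul !tliftE. Qed.

Lemma tmul_linearl t : linear (tmul^~ t).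
Proof. exact: tlift_is_linear. Qed.

Lemma tmul_linearr s : linear (tmul s).
Proof.
move=> c t t'; move: s; apply: tens_ext.
- exact: tmul_linearl.
- move=> d s s'; rewrite !(tmul_linearl _ _ s).
  by rewrite !scalerDr addrACA !scalerA mulrC.
- by move=> a b; rewrite /tmul !tliftE // tlift_is_linear.
Qed.

Lemma tmulA : associative tmul.
Proof.
move=> s t u; move: s; apply: tens_ext.
- exact: tmul_linearl.
- by move=> c s s'; rewrite !tmul_linearl.
move=> a b; move: t; apply: tens_ext.
- by move=> c s s'; rewrite tmul_linearl tmul_linearr.
- by move=> c s s'; rewrite tmul_linearr tmul_linearl.
move=> a' b'; move: u; apply: tens_ext.
- by move=> c s s'; rewrite !tmul_linearr.
- exact: tmul_linearr.
by move=> a'' b''; rewrite !tmulE !mulrA.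
Qed.

Lemma tmul1l : left_id tone tmul.
Proof.
apply: tens_ext => //; first exact: tmul_linearr.
by move=> a b; rewrite tmulE !mul1r.
Qed.

Lemma tmul1r : right_id tone tmul.
Proof.
apply: tens_ext => //; first exact: tmul_linearl.
by move=> a b; rewrite tmulE !mulr1.
Qed.

Lemma tmulDl : left_distributive tmul +%R.
Proof. by move=> s s' t; have := tmul_linearl t 1 s s'; rewrite !scale1r. Qed.

Lemma tmulDr : right_distributive tmul +%R.
Proof. by move=> s t t'; have := tmul_linearr s 1 t t'; rewrite !scale1r. Qed.

Lemma tone_neq0 : tone != 0.
Proof.
have nz (C : falgType K) : exists i, v2r (1 : C) 0 i != 0.
  apply/existsP; apply: contra_neqT (oner_neq0 C) => /existsPn h.
  apply/v2r_inj/rowP => i; rewrite linear0 mxE.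
  by have := h i; rewrite negbK => /eqP.
have [[i hi] [j hj]] := (nz A, nz B).
apply/eqP => h; have := tcoefE (1 : A) (1 : B) i j.
rewrite [_ ⊗ _]h [LHS]mxE => /esym/eqP.
by rewrite mulf_eq0 (negPf hi) (negPf hj).
Qed.

HB.instance Definition _ := GRing.Zmodule_isNzRing.Build (tensor A B)
  tmulA tmul1l tmul1r tmulDl tmulDr tone_neq0.

Lemma tensM (a a' : A) (b b' : B) :
  (a ⊗ b) * (a' ⊗ b') = (a * a') ⊗ (b * b').
Proof. exact: tmulE. Qed.

Lemma tscaleAl c s t : c *: (s * t) = (c *: s) * t.
Proof.
exact/esym/(linear_scale_fun _ _ (tmul_linearl t)).
Qed.

Lemma tscaleAr c s t : c *: (s * t) = s * (c *: t).
Proof.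
exact/esym/(linear_scale_fun _ _ (tmul_linearr s)).
Qed.

HB.instance Definition _ :=
  GRing.Lmodule_isLalgebra.Build K (tensor A B) tscaleAl.
HB.instance Definition _ :=
  GRing.Lalgebra_isAlgebra.Build K (tensor A B) tscaleAr.
HB.instance Definition _ := Algebra_isFalgebra.Build K (tensor A B).

End TensorAlg.

HB.mixin Record isStarAlgebra (R : rcfType) A of Falgebra R[i] A := {
  star : A -> A;
  starK : involutive star;
  starD : {morph star : x y / x + y};
  starZ : forall (c : R[i]) x, star (c *: x) = Num.conj c *: star x;
  starM : forall x y, star (x * y) = star y * star x
}.

#[short(type="starAlgType")]
HB.structure Definition StarAlgebra (R : rcfType) :=
  {A of isStarAlgebra R A & Falgebra R[i] A}.

Section TensorStar.
Variables (R : rcfType) (A B : starAlgType R).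
Implicit Types (s t : tensor A B).

Definition tstar t : tensor A B :=
  \sum_i \sum_j Num.conj (tcoef t i j) *: (star (vbase i) ⊗ star (vbase j)).

Lemma tstarP c s t : tstar (c *: s + t) = Num.conj c *: tstar s + tstar t.
Proof.
rewrite /tstar scaler_sumr -big_split /=; apply: eq_bigr => i _.
rewrite scaler_sumr -big_split /=; apply: eq_bigr => j _.
by rewrite tcoef_is_linear rmorphD rmorphM scalerDl scalerA.
Qed.

Lemma star_sum (C : starAlgType R) (I : finType) (c : I -> R[i]) (x : I -> C) :
  star (\sum_i c i *: x i) = \sum_i Num.conj (c i) *: star (x i).
Proof.
have s0 : star (0 : C) = 0.
  by apply: (addrI (star (0 : C))); rewrite -starD !addr0.
rewrite (big_morph _ (@starD _ C) s0).
by apply: eq_bigr => i _; rewrite starZ.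
Qed.

Lemma tstarE (a : A) (b : B) : tstar (a ⊗ b) = star a ⊗ star b.
Proof.
rewrite [in RHS](vbaseE a) star_sum.
rewrite (@linear_sum_fun _ _ _ (fun x : A => x ⊗ star b)); last first.
  exact: tens_linearl.
apply: eq_bigr => i _; rewrite [in RHS](vbaseE b) star_sum.
rewrite (@linear_sum_fun _ _ _ (fun x : B => star (vbase i) ⊗ x)); last first.
  exact: tens_linearr.
rewrite scaler_sumr; apply: eq_bigr => j _.
by rewrite tcoefE rmorphM scalerA.
Qed.

Lemma tstarK : involutive tstar.
Proof.
apply: (@tens_ext _ _ _ _ (fun t => tstar (tstar t)) id) => //.
  by move=> c s t; rewrite !tstarP conjCK.
by move=> a b; rewrite !tstarE !starK.
Qed.

Lemma tstarD : {morph tstar : s t / s + t}.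
Proof. by move=> s t; have := tstarP 1 s t; rewrite rmorph1 !scale1r. Qed.

Lemma tstarZ (c : R[i]) t : tstar (c *: t) = Num.conj c *: tstar t.
Proof.
have t0 : tstar 0 = 0.
  by apply: (addrI (tstar 0)); rewrite -tstarD !addr0.
by have := tstarP c t 0; rewrite t0 !addr0.
Qed.

Lemma tstarM s t : tstar (s * t) = tstar t * tstar s.
Proof.
apply: (can_inj tstarK); rewrite tstarK.
move: s; apply: (@tens_ext _ _ _ _ (fun s => s * t)
  (fun s => tstar (tstar t * tstar s))).
- by move=> c s s'; rewrite mulrDl scalerAl.
- by move=> c s s'; rewrite tstarP mulrDr -scalerAr tstarP conjCK.
move=> a b; move: t; apply: (@tens_ext _ _ _ _ (fun t => a ⊗ b * t)
  (fun t => tstar (tstar t * tstar (a ⊗ b)))).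
- by move=> c s s'; rewrite mulrDr scalerAr.
- by move=> c s s'; rewrite tstarP mulrDl -scalerAl tstarP conjCK.
by move=> a' b'; rewrite !tstarE !tensM tstarE !starM !starK.
Qed.

HB.instance Definition _ := isStarAlgebra.Build R (tensor A B)
  tstarK tstarD tstarZ tstarM.

Lemma star_tens (a : A) (b : B) : star (a ⊗ b) = star a ⊗ star b.
Proof. exact: tstarE. Qed.

End TensorStar.

(* As for MathComp norms, the values are nonnegative reals inside R[i].
   Completeness for the norm is automatic in finite dimension. *)
HB.mixin Record isCstarAlgebra (R : rcfType) A of StarAlgebra R A := {
  cnorm : A -> R[i];
  cnormD : forall x y, cnorm (x + y) <= cnorm x + cnorm y;
  cnormZ : forall (c : R[i]) x, cnorm (c *: x) = `|c| * cnorm x;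
  cnorm0_eq0 : forall x, cnorm x = 0 -> x = 0;
  cnormM : forall x y, cnorm (x * y) <= cnorm x * cnorm y;
  cnorm_star : forall x, cnorm (star x * x) = cnorm x ^+ 2
}.

#[short(type="cstarAlgType")]
HB.structure Definition CstarAlgebra (R : rcfType) :=
  {A of isCstarAlgebra R A & StarAlgebra R A}.

(* The carrier of a finQuantumGroupType is the algebra of functions F(G). *)
HB.mixin Record isFinQuantumGroup (R : rcfType) A of CstarAlgebra R A := {
  comul : {lrmorphism A -> tensor A A};
  counit : {lrmorphism A -> R[i]^o};
  antipode : {linear A -> A};
  comul_star : forall x, comul (star x) = star (comul x);
  comulA : forall x,
    tassoc (tmap comul idfun (comul x)) = tmap idfun comul (comul x);
  comul_counitl : forall x, tlift (fun a b => counit a *: b) (comul x) = x;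
  comul_counitr : forall x, tlift (fun a b => counit b *: a) (comul x) = x;
  antipodel : forall x,
    tlift (fun a b => antipode a * b) (comul x) = (counit x)%:A;
  antipoder : forall x,
    tlift (fun a b => a * antipode b) (comul x) = (counit x)%:A
}.

#[short(type="finQuantumGroupType")]
HB.structure Definition FinQuantumGroup (R : rcfType) :=
  {A of isFinQuantumGroup R A & CstarAlgebra R A}.

Section RandomWalk.
Variables (R : realType) (G : finQuantumGroupType R).
Implicit Types (mu nu pi : G -> R[i]) (p x y : G).

Definition state mu :=
  [/\ scalar mu, forall x, 0 <= mu (star x * x) & mu 1 = 1].

Definition conv mu nu : G -> R[i] :=
  fun x => tlift (fun a b => mu a * nu b : R[i]^o) (comul x).

(* The k-th convolution power, for 1 <= k. *)
Definition convpow nu (k : nat) : G -> R[i] := iter k.-1 (conv nu) nu.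

Definition haar_state pi :=
  state pi /\ forall mu, state mu -> conv pi mu =1 pi /\ conv mu pi =1 pi.

Lemma haar_state_unique pi pi' : haar_state pi -> haar_state pi' -> pi =1 pi'.
Proof.
move=> [spi hpi] [spi' hpi'] x.
by rewrite -(hpi _ spi').1 (hpi' _ spi).2.
Qed.

(* On the finite-dimensional dual of F(G), norm convergence is pointwise
   convergence; R[i]^o is R[i] with its usual topology. *)
Definition ergodic nu := exists2 pi, haar_state pi &
  forall x, (convpow nu k x : R[i]^o) @[k --> \oo] --> (pi x : R[i]^o).

Definition stoch_op nu : G -> G :=
  fun x => tlift (fun a b => nu a *: b) (comul x).

Definition projection p := star p = p /\ p * p = p.

Definition cstar_le x y := exists z, y - x = star z * z.

Definition group_like_projection p :=
  [/\ projection p, p <> 0 & comul p * (1 ⊗ p) = p ⊗ p].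

Definition supported_on_proper_quasi_subgroup nu :=
  exists p, [/\ group_like_projection p, p <> 1 & nu p = 1].

Definition supported_on_cyclic_coset nu :=
  exists p0 p1,
    [/\ projection p0 /\ projection p1,
        p0 * p1 = 0 /\ cstar_le (p0 + p1) 1,
        nu p1 = 1,
        group_like_projection p0 &
        stoch_op nu p1 = p0 /\
        exists2 d : nat, (1 < d)%N & iter d (stoch_op nu) p1 = p1].

End RandomWalk.

(* Main.v *)
From HB Require Import structures.
Require Import Defs.
From mathcomp Require Import all_boot all_order all_algebra all_field.
From mathcomp Require Import complex.
From mathcomp Require Import all_classical all_reals all_analysis.
From mathcomp Require Import ring lra.

Set Implicit Arguments.
Unset Strict Implicit.
Unset Printing Implicit Defensive.

Import Order.TTheory GRing.Theory Num.Theory.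
Import VectorInternalTheory.
Import numFieldNormedType.Exports.

Local Open Scope ring_scope.
Local Open Scope complex_scope.
Local Open Scope classical_set_scope.

(** Let T = (nu (x) id) Delta be the stochastic operator and eps the counit. As
    nu = eps o T, the convolution powers are eps o T^k, so everything is decided
    by the eigenvalues of T on the unit circle.

    A faithful invariant state is obtained without any limiting process: the
    normalised trace h of the left regular representation. It is faithful
    because a selfadjoint element acts with real eigenvalues and is never a
    non-zero nilpotent (ltrace_star_mul). The Galois map
    a (x) b |-> Delta(a)(1 (x) b) conjugates left multiplication by x (x) 1 into
    left multiplication by Delta(x), so that (h (x) h) Delta = h
    (ltrace_conv), and a faithful state with this property is the Haar state
    (haar_invl, haar_invr).

    If T x = c x, put D = Delta(x) - c 1 (x) x. A direct expansion gives
    (nu (x) h)(D^* D) = (1 - |c|^2) h(x^* x) (eigen_defect). Since nu (x) h is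
    positive, |c| <= 1; if |c| = 1 then D is a null vector of nu (x) h, and
    Cauchy-Schwarz yields T(y x) = c T(y) x for all y (markovM). Peripheral
    eigenvectors therefore multiply, and their eigenvalues multiply with them.

    - If T has a fixed point that is not scalar, its fixed points form a unital
      star-subalgebra E other than the scalars, invariant under all
      (id (x) g) Delta. The projection p of E with x p = eps(x) p on E is
      group-like, differs from 1, and nu(p) = eps(T p) = 1 (fixed_nonscalar).
    - If the fixed points are scalar and some x that is not scalar has T x = c x
      with |c| = 1, then x is a multiple of a unitary u with
      Delta(u) = u (x) u, c has some finite order d > 1, and u^d = 1. The
      spectral projections p_i = 1/d sum_k (c^-i u)^k satisfy T p_1 = p_0 and
      T^d p_1 = p_1, and p_0 is group-like (unimodular_nonscalar).
    - Otherwise T - h(.)1 has all its eigenvalues in the open unit disc, its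
      powers tend to 0, and nu^{*k} tends to h (peripheral_ergodic).

    Conversely, a projection p whose value nu^{*k}(p) is 1 for arbitrarily large
    k has h(p) = 1 in the ergodic case, hence p = 1. A group-like p with
    nu(p) = 1 has this property, and so does p_1 in a cyclic coset because
    T^d p_1 = p_1. *)

(** * Positive functionals on star-algebras *)

Lemma eq_sub_eq (V : zmodType) (a b c d : V) : a = b -> c - d = a - b -> c = d.
Proof. by move=> -> /eqP; rewrite subrr subr_eq0 => /eqP. Qed.

Lemma eq_sub_eq2 (V : zmodType) (a b a' b' c d : V) :
  a = b -> a' = b' -> c - d = (a - b) + (a' - b') -> c = d.
Proof. by move=> -> ->; rewrite !subrr addr0 => /eqP; rewrite subr_eq0 => /eqP. Qed.

Section Tensors.
Variables (K : fieldType).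

Lemma tens_ind (U V : vectType K) (P : tensor U V -> Prop) :
  (forall u v, P (u ⊗ v)) -> (forall s t, P s -> P t -> P (s + t)) ->
  forall t, P t.
Proof.
move=> Ppure Padd t.
have P0 : P 0.
  have <- : (0 : U) ⊗ (0 : V) = 0.
    by rewrite -(scale0r 0) (linear_scale_fun _ _ (tens_linearl _)) scale0r.
  exact: Ppure.
rewrite (tensE t) /tlift; elim/big_ind: _ => // i _.
elim/big_ind: _ => // j _.
by rewrite -(linear_scale_fun _ _ (tens_linearl _)).
Qed.

End Tensors.

Section PositiveFunctionals.
Variables (R : rcfType) (A : starAlgType R).
Implicit Types (w : {scalar A}) (x y z : A).

Lemma star0 : star 0 = 0 :> A.
Proof. by apply: (addrI (star 0)); rewrite -starD !addr0. Qed.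

Lemma starN x : star (- x) = - star x.
Proof. by apply: (addrI (star x)); rewrite -starD !subrr star0. Qed.

Lemma starB x y : star (x - y) = star x - star y.
Proof. by rewrite starD starN. Qed.

Lemma star1 : star 1 = 1 :> A.
Proof. by rewrite -[LHS]mulr1 -[X in _ * X]starK -starM mulr1 starK. Qed.

Lemma starX x n : star (x ^+ n) = star x ^+ n.
Proof. by elim: n => [|n ih]; rewrite ?expr0 ?star1 // exprS starM ih -exprSr. Qed.

Definition positive w := forall x, 0 <= w (star x * x).
Definition faithful w := forall x, w (star x * x) = 0 -> x = 0.

Lemma sqr_addZ w (a : R[i]) x y : w (star (x + a *: y) * (x + a *: y)) =
  w (star x * x) + a * w (star x * y) + Num.conj a * w (star y * x)
  + a * Num.conj a * w (star y * y).
Proof.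
have -> : star (x + a *: y) * (x + a *: y) = star x * x + a *: (star x * y)
    + (Num.conj a *: (star y * x) + Num.conj a *: (a *: (star y * y))).
  by rewrite starD starZ mulrDl !mulrDr -!scalerAl -!scalerAr.
rewrite !linearD !linearZ /=; ring.
Qed.

Lemma sqr_add_orth w x y : w (star x * y) = 0 -> w (star y * x) = 0 ->
  w (star (x + y) * (x + y)) = w (star x * x) + w (star y * y).
Proof.
by move=> xy yx; rewrite starD mulrDl !mulrDr !linearD /= xy yx addr0 add0r.
Qed.

Lemma scalar_mul_sum (w : {scalar A}) x (I : Type) (s : seq I) (F : I -> A) :
  w (x * \sum_(i <- s) F i) = \sum_(i <- s) w (x * F i).
Proof. by rewrite mulr_sumr linear_sum. Qed.

(** Expanding w((x + a y)^* (x + a y)) for a = 1 and a = i shows that both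
    w(x^* y) + w(y^* x) and i (w(x^* y) - w(y^* x)) are real. *)
Lemma positive_conj w x y : positive w -> w (star y * x) = Num.conj (w (star x * y)).
Proof.
move=> wp.
have re z : Num.conj (w (star z * z)) = w (star z * z).
  exact/conj_Creal/ger0_real.
have key a : Num.conj a * Num.conj (w (star x * y)) + a * Num.conj (w (star y * x))
    = a * w (star x * y) + Num.conj a * w (star y * x).
  have := re (x + a *: y); rewrite sqr_addZ !rmorphD !rmorphM /= !conjCK !re.
  move=> h; apply: (eq_sub_eq h). ring.
have k1 := key 1; have ki := key 'i%R; rewrite rmorph1 in k1.
rewrite conjCi in ki.
set p := w (star x * y) in k1 ki *; set q := w (star y * x) in k1 ki *.
have {}ki : - Num.conj p + Num.conj q = p - q.
  apply: (mulfI (neq0Ci R[i])); apply: (eq_sub_eq ki); ring.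
have two : (2 : R[i]) != 0 by rewrite pnatr_eq0.
apply: (mulfI two); apply: (eq_sub_eq2 (esym k1) ki). ring.
Qed.

Lemma positive_star w x : positive w -> w (star x) = Num.conj (w x).
Proof.
by move=> wp; have := positive_conj 1 x wp; rewrite mulr1 star1 mul1r.
Qed.

(** The degenerate case of Cauchy-Schwarz: if w(z y) were not 0, the value of w
    at (z^* + a y)^* (z^* + a y), which is affine in a and its conjugate because
    w(y^* y) = 0, would be negative for a suitable a. *)
Lemma positive_null w y z : positive w -> w (star y * y) = 0 -> w (z * y) = 0.
Proof.
move=> wp y0; set v := star z.
have zv : z = star v by rewrite /v starK.
apply/eqP/negP => /negP ne0.
set p := w (z * y) in ne0 *.
set c := w (star v * v).
have pq : w (star y * v) = Num.conj p by rewrite (positive_conj _ _ wp) -zv.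
(* With this a the value of w below is c - (c + 1) = -1. *)
pose a := - (c + 1) / (2 * p).
have := wp (v + a *: y); rewrite sqr_addZ y0 mulr0 addr0 -/c pq -zv -/p.
have ap : a * p = - (c + 1) / 2 by rewrite /a; field; rewrite ne0.
have apc : Num.conj a * Num.conj p = - (c + 1) / 2.
  rewrite -rmorphM ap; apply: conj_Creal.
  apply: realM; last by rewrite realV realn.
  rewrite realN; apply: realD; last exact: real1.
  exact/ger0_real/wp.
rewrite apc ap.
suff -> : c + - (c + 1) / 2 + - (c + 1) / 2 = -1 by rewrite oppr_ge0 ler10.
by field.
Qed.
End PositiveFunctionals.

(** * Slices and product functionals on a tensor product *)
Section Slices.
Variables (K : fieldType) (U V : vectType K).
Implicit Types (f : {scalar U}) (g : {scalar V}) (t : tensor U V).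

Definition slicel (f : U -> K) t : V := tlift (fun a b => f a *: b) t.
Definition slicer (g : V -> K) t : U := tlift (fun a b => g b *: a) t.
Definition tfun (f : U -> K) (g : V -> K) t : K :=
  tlift (fun a b => f a * g b : K^o) t.

HB.instance Definition _ (f : U -> K) :=
  GRing.isLinear.Build K (tensor U V) V _ (slicel f) (tlift_is_linear _).
HB.instance Definition _ (g : V -> K) :=
  GRing.isLinear.Build K (tensor U V) U _ (slicer g) (tlift_is_linear _).

Lemma tfun_is_scalar (f : U -> K) (g : V -> K) : scalar (tfun f g).
Proof. by move=> c s t; rewrite /tfun linearP. Qed.

HB.instance Definition _ (f : U -> K) (g : V -> K) :=
  GRing.isLinear.Build K (tensor U V) K *%R (tfun f g) (tfun_is_scalar f g).

Lemma slicelE f u v : slicel f (u ⊗ v) = f u *: v.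
Proof.
rewrite /slicel tliftE //; split=> [y|y] c a b.
  by rewrite linearP scalerDl scalerA.
by rewrite scalerDr !scalerA mulrC.
Qed.

Lemma slicerE g u v : slicer g (u ⊗ v) = g v *: u.
Proof.
rewrite /slicer tliftE //; split=> [y|y] c a b.
  by rewrite scalerDr !scalerA mulrC.
by rewrite linearP scalerDl scalerA.
Qed.

Lemma tfunE f g u v : tfun f g (u ⊗ v) = f u * g v.
Proof.
rewrite /tfun tliftE //; split=> [y|y] c a b.
  by rewrite linearP mulrDl -mulrA.
by rewrite linearP mulrDr mulrCA.
Qed.

Lemma tfunD (f : U -> K) (g : V -> K) s t :
  tfun f g (s + t) = tfun f g s + tfun f g t.
Proof. exact: linearD. Qed.

Lemma tfun0 (f : U -> K) (g : V -> K) : tfun f g 0 = 0.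
Proof. exact: linear0. Qed.

Lemma tfun_slicel f g t : tfun f g t = g (slicel f t).
Proof.
elim/tens_ind: t => [u v|s t hs ht]; first by rewrite tfunE slicelE linearZ.
by rewrite !linearD /= hs ht.
Qed.

Lemma tfun_slicer f g t : tfun f g t = f (slicer g t).
Proof.
elim/tens_ind: t => [u v|s t hs ht].
  by rewrite tfunE slicerE linearZ /= mulrC.
by rewrite !linearD /= hs ht.
Qed.

(** The slices by the coordinate functionals are the columns of the coefficient
    matrix of the tensor. *)
Lemma slicer_inj s t : (forall g, slicer g s = slicer g t) -> s = t.
Proof.
move=> h; apply: tcoefP => i j.
have lin : scalar (fun v : V => v2r v 0 j) by move=> c u v; rewrite linearP !mxE.
pose g : {scalar V} := HB.pack (fun v : V => v2r v 0 j)
  (GRing.isLinear.Build K V K *%R _ lin).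
suff E x : tcoef x i j = v2r (slicer g x) 0 i by rewrite !E h.
elim/tens_ind: x => [u v|x y hx hy].
  by rewrite tcoefE slicerE linearZ /= !mxE mulrC.
by rewrite linearD linearD mxE -hx -hy /tcoef mxE.
Qed.

Lemma tensDl u u' (v : V) : (u + u') ⊗ v = u ⊗ v + u' ⊗ v :> tensor U V.
Proof. by have := tens_linearl v 1 u u'; rewrite !scale1r. Qed.

Lemma tensDr u (v v' : V) : u ⊗ (v + v') = u ⊗ v + u ⊗ v' :> tensor U V.
Proof. by have := tens_linearr u 1 v v'; rewrite !scale1r. Qed.

Lemma tensZl c u (v : V) : (c *: u) ⊗ v = c *: (u ⊗ v) :> tensor U V.
Proof. exact: (linear_scale_fun _ _ (tens_linearl v)). Qed.

Lemma tensZr c u (v : V) : u ⊗ (c *: v) = c *: (u ⊗ v) :> tensor U V.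
Proof. exact: (linear_scale_fun _ _ (tens_linearr u)). Qed.

Lemma tens0l (v : V) : 0 ⊗ v = 0 :> tensor U V.
Proof. by rewrite -(scale0r 0) tensZl scale0r. Qed.

Lemma tens0r (u : U) : u ⊗ 0 = 0 :> tensor U V.
Proof. by rewrite -(scale0r 0) tensZr scale0r. Qed.

Lemma tens_seq t : exists s : seq (U * V), t = \sum_(p <- s) p.1 ⊗ p.2.
Proof.
elim/tens_ind: t => [u v|t1 t2 [s1 ->] [s2 ->]].
  by exists [:: (u, v)]; rewrite big_seq1.
by exists (s1 ++ s2); rewrite big_cat.
Qed.

End Slices.

Section ProductFunctional.
Variables (R : rcfType) (A B : starAlgType R).
Variables (f : {scalar A}) (g : {scalar B}).
Hypotheses (fpos : positive f) (gpos : positive g) (gfaith : faithful g).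

Lemma tfun_orthl t (z : A) (b : B) s :
    t = \sum_(p <- s) p.1 ⊗ p.2 -> all (fun p : A * B => g (star b * p.2) == 0) s ->
  tfun f g (star (z ⊗ b) * t) = 0.
Proof.
move=> -> /allP hs; rewrite scalar_mul_sum big1_seq // => p /hs /eqP hp.
by rewrite star_tens tensM /= tfunE hp mulr0.
Qed.

Lemma tfun_star t : tfun f g (star t) = Num.conj (tfun f g t).
Proof.
elim/tens_ind: t => [a b|s t hs ht].
  by rewrite star_tens !tfunE rmorphM !positive_star.
by rewrite starD !tfunD rmorphD hs ht.
Qed.

(** Gram-Schmidt in the second leg, by induction on the number of terms: for
    t = a (x) b + ..., subtract from every other second leg its component along
    b. This writes t = t' + z (x) b with t' orthogonal to z (x) b and with one
    term less, and (f (x) g)(t^* t) splits as the value for t' plus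
    f(z^* z) g(b^* b). *)
Lemma tfun_pos_faithful t :
  0 <= tfun f g (star t * t) /\
  (faithful f -> tfun f g (star t * t) = 0 -> t = 0).
Proof.
have [s] := tens_seq t.
have [n] := ubnP (size s); elim: n => // n ih in s t *.
case: s => [|[a b] s] /=; rewrite ?ltnS => sz.
  rewrite big_nil => ->; rewrite mulr0 tfun0; split=> //.
rewrite big_cons /= => ht.
have [b0|bn0] := eqVneq b 0.
  apply: (ih s) => //; rewrite ht b0.
  by rewrite tens0r add0r.
set beta := g (star b * b).
have beta_gt0 : 0 < beta.
  rewrite lt_def gpos andbT; apply: contra_neq bn0; exact: gfaith.
have betan0 := lt0r_neq0 beta_gt0.
pose c (x : B) := g (star b * x) / beta.
pose s' := [seq (p.1, p.2 - c p.2 *: b) | p <- s].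
pose z := a + \sum_(p <- s) c p.2 *: p.1.
pose t' := \sum_(p <- s') p.1 ⊗ p.2.
have {ht} ht : t = t' + z ⊗ b.
  rewrite ht /t' /z big_map tensDl addrCA; congr (_ + _).
  elim: (s) => [|p r ihr].
    by rewrite !big_nil tens0l addr0.
  rewrite !big_cons ihr /= tensDl tensDr -scaleNr tensZr tensZl.
  by rewrite scaleNr addrACA subrK.
have sz' : (size s' < n)%N by rewrite size_map.
have [pos0 faith0] := ih s' t' sz' erefl.
have o1 : tfun f g (star (z ⊗ b) * t') = 0.
  apply: (@tfun_orthl _ _ _ s') => //; apply/allP => q /mapP[p ps ->] /=.
  rewrite mulrBr linearB /= -scalerAr linearZ /= -/beta.
  by rewrite /c divfK // subrr.
have o2 : tfun f g (star t' * (z ⊗ b)) = 0.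
  by rewrite -[star t' * _]starK starM starK tfun_star o1 ?rmorph0.
have E : tfun f g (star t * t) = tfun f g (star t' * t') + f (star z * z) * beta.
  by rewrite ht (sqr_add_orth o2 o1) star_tens tensM /= tfunE.
have fz := fpos z.
have zb : 0 <= f (star z * z) * beta by rewrite mulr_ge0 // ltW.
split; first by rewrite E addr_ge0.
move=> ff /eqP; rewrite E paddr_eq0 // mulf_eq0 (negPf betan0) orbF.
case/andP => /eqP /(faith0 ff) t0 /eqP /ff z0.
rewrite ht t0 z0 add0r tens0l //.
Qed.

Lemma tfun_positive : positive (tfun f g).
Proof. by move=> t; have [] := tfun_pos_faithful t. Qed.

Lemma tfun_faithful : faithful f -> faithful (tfun f g).
Proof. by move=> ff t; have [_] := tfun_pos_faithful t; apply. Qed.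

End ProductFunctional.

(** * The regular trace of a finite-dimensional C*-algebra *)
Section TraceOfSquare.
Variable C : numClosedFieldType.

(** In triangular form the trace of M^2 is the sum of the squares of the
    eigenvalues. If these are all 0 the characteristic polynomial is X^n, and
    Cayley-Hamilton applies. *)
Lemma trace_sqr_ge0 n (M : 'M[C]_n) :
    (forall a, eigenvalue M a -> a \is Num.real) ->
  0 <= \tr (M *m M) /\ (\tr (M *m M) = 0 -> M ^+ n = 0).
Proof.
case: n M => [|n] M Mreal.
  by split; rewrite ?[\tr _]big_ord0 // => _; apply/matrixP; case.
have [P /unitarymx_unit Pu] := Schur M (ltn0Sn n).
rewrite /similar_to conjumx // => Btrig.
set B := P *m M *m invmx P in Btrig.
have ME : M = invmx P *m B *m P by rewrite /B !mulmxA mulVmx // mul1mx mulmxKV.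
clearbody B.
have Breal i : B i i \is Num.real.
  apply: Mreal.
  have : eigenvalue B (B i i).
    rewrite eigenvalue_root_char char_poly_trig // rootE horner_prod (bigD1 i) //=.
    by rewrite hornerXsubC subrr mul0r.
  case/eigenvalueP => v vB v0; apply/eigenvalueP; exists (v *m P).
    by rewrite ME !mulmxA mulmxK // vB scalemxAl.
  apply: contra_neq v0 => vP0.
  by rewrite -(mulmxK Pu v) vP0 mul0mx.
have trE : \tr (M *m M) = \sum_i B i i ^+ 2.
  rewrite ME !mulmxA mulmxK // mxtrace_mulC !mulmxA mulmxV // mul1mx.
  apply: eq_bigr => i _; rewrite mxE (bigD1 i) //= big1 ?addr0 // => j ji.
  have /is_trig_mxP trig := Btrig.
  have [ij|ij|/val_inj ij] := ltngtP i j.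
  - by rewrite trig // mul0r.
  - by rewrite (trig j i) // mulr0.
  - by rewrite ij eqxx in ji.
have sq i : 0 <= B i i ^+ 2 by rewrite real_exprn_even_ge0.
rewrite trE; split; first by apply: sumr_ge0.
move=> /eqP; rewrite psumr_eq0 // => /allP B0.
have {}B0 i : B i i = 0.
  by apply/eqP; rewrite -sqrf_eq0; apply: B0; rewrite mem_index_enum.
have Bn : B ^+ n.+1 = 0.
  have := Cayley_Hamilton B; rewrite char_poly_trig //.
  under eq_bigr do rewrite B0 subr0.
  by rewrite prodr_const card_ord rmorphXn /= horner_mx_X.
have MB k : M ^+ k = invmx P *m B ^+ k *m P.
  elim: k => [|k ih]; first by rewrite !expr0 mulmx1 mulVmx.
  have XS (N : 'M[C]_n.+1) : N ^+ k.+1 = N *m N ^+ k by rewrite exprS.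
  by rewrite !XS ih {1}ME !mulmxA mulmxK.
by rewrite MB Bn mulmx0 mul0mx.
Qed.

End TraceOfSquare.

Section RegularTrace.
Variables (K : fieldType) (A : falgType K).
Implicit Types x y : A.

(** The matrix of the left multiplication by x, acting on row vectors of
    coordinates; hence the order reversal in lmxM. *)
Definition lmx x : 'M[K]_(dim A) := \matrix_(i, j) v2r (x * vbase i) 0 j.

Lemma v2rM x y : v2r (x * y) = v2r y *m lmx x.
Proof.
rewrite {1}(vbaseE y) mulr_sumr linear_sum /=; apply/rowP => j.
rewrite summxE mxE; apply: eq_bigr => i _.
by rewrite -scalerAr linearZ /= !mxE.
Qed.

Lemma lmx_ext M x : (forall y, v2r (x * y) = v2r y *m M) -> lmx x = M.
Proof.
move=> h; apply/row_matrixP => i.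
by rewrite !rowE -{1 2}[delta_mx 0 i]r2vK -v2rM -h.
Qed.

Lemma lmxM x y : lmx (x * y) = lmx y *m lmx x.
Proof. by apply: lmx_ext => z; rewrite -mulrA !v2rM mulmxA. Qed.

Lemma lmx1 : lmx 1 = 1%:M.
Proof. by apply: lmx_ext => z; rewrite mul1r mulmx1. Qed.

Lemma lmxX x n : lmx (x ^+ n) = lmx x ^+ n.
Proof.
elim: n => [|n ih]; first by rewrite !expr0 lmx1.
by rewrite exprSr lmxM ih exprS.
Qed.

Lemma lmx_inj x : lmx x = 0 -> x = 0.
Proof. by move=> h; apply: v2r_inj; rewrite linear0 -[x]mulr1 v2rM h mulmx0. Qed.

Definition ltrace x : K := \tr (lmx x).

Lemma ltrace_is_scalar : scalar ltrace.
Proof.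
move=> c x y; rewrite /ltrace -mxtraceZ -mxtraceD; congr (\tr _).
by apply: lmx_ext => z; rewrite mulrDl -scalerAl linearP /= mulmxDr -scalemxAr !v2rM.
Qed.

HB.instance Definition _ := GRing.isLinear.Build K A K *%R ltrace ltrace_is_scalar.

Lemma ltraceC x y : ltrace (x * y) = ltrace (y * x).
Proof. by rewrite /ltrace !lmxM mxtrace_mulC. Qed.

Lemma ltrace1 : ltrace 1 = (dim A)%:R.
Proof. by rewrite /ltrace lmx1 mxtrace1. Qed.

Lemma dim_gt0 : (0 < dim A)%N.
Proof.
rewrite lt0n; apply: contra_neq (oner_neq0 A) => d0.
by apply/v2r_inj/rowP => k; have := ltn_ord k; rewrite {2}d0.
Qed.

Lemma ltraceE x : ltrace x = \sum_i v2r (x * vbase i) 0 i.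
Proof. by apply: eq_bigr => i _; rewrite mxE. Qed.

End RegularTrace.

Section CstarTrace.
Variables (R : rcfType) (A : cstarAlgType R).
Implicit Types x y a : A.

Lemma cnorm0 : cnorm (0 : A) = 0.
Proof. by rewrite -(scale0r (0 : A)) cnormZ normr0 mul0r. Qed.

Lemma star_mul_eq0 x : star x * x = 0 -> x = 0.
Proof.
move=> h; apply: cnorm0_eq0; have := cnorm_star x; rewrite h cnorm0 => /esym/eqP.
by rewrite sqrf_eq0 => /eqP.
Qed.

(** The C*-identity gives a = 0 from a^2 = 0, hence from a^(2^n) = 0. *)
Lemma selfadjoint_nilpotent a n : star a = a -> a ^+ n = 0 -> a = 0.
Proof.
move=> sa an; have {an} : a ^+ (2 ^ n) = 0.
  by rewrite -(subnKC (ltnW (ltn_expl n (ltnSn 1)))) exprD an mul0r.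
elim: n => [|n ih]; first by rewrite expn0 expr1.
rewrite expnSr exprM expr2 => h; apply: ih; apply: star_mul_eq0.
by rewrite starX sa.
Qed.

(** If a y = c y then (c y)^* y = y^* a y = y^* (c y), where y^* y is not 0. *)
Lemma selfadjoint_eigenvalue_real a c : star a = a -> eigenvalue (lmx a) c ->
  c \is Num.real.
Proof.
move=> sa /eigenvalueP[v va v0]; pose y : A := r2v v.
have ay : a * y = c *: y.
  by apply: v2r_inj; rewrite v2rM linearZ /= r2vK.
have yn0 : star y * y != 0.
  apply: contra_neq v0 => /star_mul_eq0 y0.
  by rewrite -(r2vK v) -/y y0 linear0.
apply/CrealP; apply/eqP; rewrite -subr_eq0.
have : (Num.conj c - c) *: (star y * y) = 0.
  rewrite scalerBl; apply/eqP; rewrite subr_eq0.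
  by rewrite scalerAl -starZ -ay starM sa -mulrA ay scalerAr.
by move/eqP; rewrite scaler_eq0 (negPf yn0) orbF.
Qed.

Lemma ltrace_sqr a : star a = a ->
  0 <= ltrace (a * a) /\ (ltrace (a * a) = 0 -> a = 0).
Proof.
move=> sa; have := @trace_sqr_ge0 _ _ (lmx a) (fun c => selfadjoint_eigenvalue_real sa).
rewrite /ltrace lmxM => -[ge0 eq0]; split=> // /eq0.
by rewrite -lmxX => /lmx_inj; apply: selfadjoint_nilpotent.
Qed.

(** For the selfadjoint elements a = x + x^* and b = i (x - x^* ), one has
    a^2 + b^2 = 2 (x^* x + x x^* ), and the trace takes the same value on x^* x
    and on x x^*. *)
Lemma ltrace_star_mul x :
  0 <= ltrace (star x * x) /\ (ltrace (star x * x) = 0 -> x = 0).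
Proof.
pose a := x + star x; pose b := 'i%R *: (x - star x).
have sa : star a = a by rewrite starD starK addrC.
have sb : star b = b.
  by rewrite starZ starB starK conjCi scaleNr -scalerN opprB.
have E : a * a + b * b = (star x * x + x * star x) *+ 2.
  have i2 : 'i%R * 'i%R = -1 :> R[i] by rewrite -expr2 sqrCi.
  rewrite /b -scalerAl -scalerAr scalerA i2 scaleN1r /a.
  rewrite !mulrDl !mulrDr !mulNr !mulrN opprK !opprD !opprK.
  rewrite addrACA [X in X + _]addrACA subrr add0r [X in _ + X]addrACA subrr addr0.
  by rewrite mulr2n addrC addrACA.
have trE : ltrace (a * a) + ltrace (b * b) = ltrace (star x * x) *+ 4.
  rewrite -linearD /= E linearMn linearD /= (ltraceC x).
  by rewrite -mulr2n -mulrnA.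
have [a0 az] := ltrace_sqr sa; have [b0 bz] := ltrace_sqr sb.
split; first by rewrite -(@pmulrn_lge0 _ _ 4) // -trE addr_ge0.
move=> x0; move/eqP: trE; rewrite x0 mul0rn paddr_eq0 //.
case/andP => /eqP /az a_0 /eqP /bz /eqP.
rewrite scaler_eq0 (negPf (neq0Ci _)) /= subr_eq0 => /eqP xs.
apply/eqP; move/eqP: a_0; rewrite /a -xs -mulr2n -scaler_nat scaler_eq0.
by rewrite pnatr_eq0.
Qed.

End CstarTrace.

(** * Slices, associativity and traces *)
Section TensorMaps.
Variables (K : fieldType).
Implicit Types U V W : vectType K.

Lemma tmap_is_linear U V U' V' (f : U -> U') (g : V -> V') : linear (tmap f g).
Proof. exact: tlift_is_linear. Qed.

HB.instance Definition _ U V U' V' (f : U -> U') (g : V -> V') :=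
  GRing.isLinear.Build K (tensor U V) (tensor U' V') _ (tmap f g)
    (tmap_is_linear f g).

HB.instance Definition _ U V W :=
  GRing.isLinear.Build K (tensor (tensor U V) W) (tensor U (tensor V W)) _
    (@tassoc K U V W) (tlift_is_linear _).

Lemma tmapE U V U' V' (f : {linear U -> U'}) (g : {linear V -> V'}) u v :
  tmap f g (u ⊗ v) = f u ⊗ g v.
Proof.
rewrite /tmap tliftE //; split=> [y|y] c a b; rewrite linearP.
  exact: tens_linearl.
exact: tens_linearr.
Qed.

Lemma slicel_tassoc U V W (f : {scalar U}) (s : tensor (tensor U V) W) :
  slicel f (tassoc s) = tmap (slicel f) idfun s.
Proof.
elim/tens_ind: s => [t w|s t hs ht]; last by rewrite !linearD /= hs ht.
elim/tens_ind: t => [u v|s t hs ht].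
  by rewrite tassocE slicelE tmapE /= slicelE tensZl.
by rewrite tensDl !linearD /= hs ht.
Qed.

Lemma slicer_tmapl U V U' (f : {linear U -> U'}) (g : {scalar V}) (t : tensor U V) :
  slicer g (tmap f idfun t) = f (slicer g t).
Proof.
elim/tens_ind: t => [u v|s t hs ht]; last by rewrite !linearD /= hs ht.
by rewrite tmapE !slicerE linearZ.
Qed.

Lemma slicel_tmapr U V V' (f : {scalar U}) (g : {linear V -> V'}) (t : tensor U V) :
  slicel f (tmap idfun g t) = g (slicel f t).
Proof.
elim/tens_ind: t => [u v|s t hs ht]; last by rewrite !linearD /= hs ht.
by rewrite tmapE !slicelE linearZ.
Qed.

Lemma slicel_tmapl U V U' (f : {scalar U'}) (g : {linear U -> U'}) (t : tensor U V) :
  slicel f (tmap g idfun t) = slicel (fun x => f (g x)) t.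
Proof.
have lin : scalar (fun x => f (g x)) by move=> c x y; rewrite !linearP.
pose fg : {scalar U} := HB.pack (fun x => f (g x)) (GRing.isLinear.Build _ _ _ _ _ lin).
rewrite -[fun x => _]/(fg : U -> K).
elim/tens_ind: t => [u v|s t hs ht]; last by rewrite !linearD /= hs ht.
by rewrite tmapE !slicelE.
Qed.

Lemma slicer_tmapr U V V' (f : {scalar V'}) (g : {linear V -> V'}) (t : tensor U V) :
  slicer f (tmap idfun g t) = slicer (fun x => f (g x)) t.
Proof.
have lin : scalar (fun x => f (g x)) by move=> c x y; rewrite !linearP.
pose fg : {scalar V} := HB.pack (fun x => f (g x)) (GRing.isLinear.Build _ _ _ _ _ lin).
rewrite -[fun x => _]/(fg : V -> K).
elim/tens_ind: t => [u v|s t hs ht]; last by rewrite !linearD /= hs ht.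
by rewrite tmapE !slicerE.
Qed.

Lemma slicel_tfun U V W (f : {scalar U}) (g : {scalar V}) (s : tensor (tensor U V) W) :
  slicel g (slicel f (tassoc s)) = slicel (tfun f g) s.
Proof.
rewrite slicel_tassoc slicel_tmapl.
by congr (slicel _ s); apply/funext => t; rewrite tfun_slicel.
Qed.

Lemma slicer_tfun U V W (f : {scalar V}) (g : {scalar W}) (s : tensor (tensor U V) W) :
  slicer f (slicer g s) = slicer (tfun f g) (tassoc s).
Proof.
elim/tens_ind: s => [t w|s t hs ht]; last by rewrite !linearD /= hs ht.
elim/tens_ind: t => [u v|s t hs ht].
  by rewrite tassocE !slicerE linearZ /= !slicerE tfunE scalerA mulrC.
by rewrite tensDl !linearD /= hs ht.
Qed.

Lemma slicel_slicer_tassoc U V W (f : {scalar U}) (g : {scalar W}) (s : tensor (tensor U V) W) :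
  slicer g (slicel f (tassoc s)) = slicel f (slicer g s).
Proof. by rewrite slicel_tassoc slicer_tmapl. Qed.

Definition ttrace U V (F : tensor U V -> tensor U V) : K :=
  \sum_i \sum_j tcoef (F (vbase i ⊗ vbase j)) i j.

(** Both sides are the sum over all pairs of basis tensors of the products of
    opposite matrix coefficients. *)
Lemma ttraceC U V (F H : {linear tensor U V -> tensor U V}) :
  ttrace (fun t => F (H t)) = ttrace (fun t => H (F t)).
Proof.
have E (X Y : {linear tensor U V -> tensor U V}) : ttrace (fun t => X (Y t)) =
    \sum_i \sum_j \sum_k \sum_l tcoef (Y (vbase i ⊗ vbase j)) k l *
      tcoef (X (vbase k ⊗ vbase l)) i j.
  apply: eq_bigr => i _; apply: eq_bigr => j _.
  rewrite [in LHS](tensE (Y _)) /tlift linear_sum /= /tcoef summxE.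
  apply: eq_bigr => k _; rewrite linear_sum summxE; apply: eq_bigr => l _.
  by rewrite linearZ !mxE.
rewrite !E pair_big_dep /=.
under eq_bigr do rewrite pair_big_dep /=.
rewrite exchange_big /= [RHS]pair_big_dep /=; apply: eq_bigr => p _.
rewrite pair_big_dep /=; apply: eq_bigr => q _.
by rewrite mulrC.
Qed.

End TensorMaps.

Section TensorTrace.
Variables (K : fieldType) (A : falgType K).

Lemma ttrace_mul (t : tensor A A) :
  ttrace (fun s => t * s) = tfun (@ltrace K A) (@ltrace K A) t.
Proof.
elim/tens_ind: t => [a b|s t hs ht].
  rewrite tfunE /= !ltraceE /ttrace big_distrlr /=.
  apply: eq_bigr => i _; apply: eq_bigr => j _.
  by rewrite tensM tcoefE.
rewrite tfunD -hs -ht -big_split /=; apply: eq_bigr => i _.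
rewrite -big_split /=; apply: eq_bigr => j _.
by rewrite mulrDl /tcoef mxE.
Qed.
End TensorTrace.

(** * Counit, coassociativity and the Galois map *)
Section HopfAlgebra.
Variables (R : rcfType) (G : finQuantumGroupType R).
Implicit Types (x y : G) (t : tensor G G).

Definition eps : G -> R[i] := @counit R G.

Lemma eps_is_scalar : scalar eps.
Proof. by move=> c x y; rewrite /eps linearP. Qed.

HB.instance Definition _ := GRing.isLinear.Build R[i] G R[i] *%R eps eps_is_scalar.

Lemma epsM x y : eps (x * y) = eps x * eps y.
Proof. by rewrite /eps rmorphM. Qed.

Lemma eps1 : eps 1 = 1.
Proof. by rewrite /eps rmorph1. Qed.

Lemma slicel_eps x : slicel eps (comul x) = x.
Proof. exact: comul_counitl. Qed.

Lemma slicer_eps x : slicer eps (comul x) = x.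
Proof. exact: comul_counitr. Qed.

(** The conjugate of eps o star is again a left counit, and a left counit equals
    a right one. *)
Lemma eps_star x : eps (star x) = Num.conj (eps x).
Proof.
have lin : scalar (fun x => Num.conj (eps (star x))).
  by move=> c u v; rewrite starD starZ linearP /= rmorphD rmorphM /= conjCK.
pose e : {scalar G} := HB.pack (fun x => Num.conj (eps (star x)))
  (GRing.isLinear.Build _ _ _ _ _ lin).
have slice_star t : slicel e (star t) = star (slicel eps t).
  elim/tens_ind: t => [a b|s t hs ht].
    by rewrite star_tens !slicelE starZ /= starK.
  by rewrite starD linearD /= hs ht -starD -linearD.
have e_eps z : e z = eps z.
  rewrite -{1}(slicer_eps z) -tfun_slicer tfun_slicel; congr (eps _).
  by rewrite -{1}(starK z) comul_star slice_star slicel_eps starK.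
by rewrite -e_eps /= starK.
Qed.

(** Slicing on the left commutes with slicing on the right: both sides slice the
    two outer legs of the twice iterated comultiplication. *)
Lemma comul_slice (f g : {scalar G}) x :
  slicel f (comul (slicer g (comul x))) = slicer g (comul (slicel f (comul x))).
Proof.
by rewrite -slicer_tmapl -slicel_tmapr -comulA slicel_slicer_tassoc.
Qed.

(** Successive slices by f and g amount to one slice by the convolution of f
    and g. *)
Lemma slicel_conv (f g : {scalar G}) x :
  slicel g (comul (slicel f (comul x))) =
  slicel (fun y => tfun f g (comul y)) (comul x).
Proof.
by rewrite -slicel_tmapr -comulA slicel_tfun slicel_tmapl.
Qed.

Lemma slicer_conv (f g : {scalar G}) x :
  slicer f (comul (slicer g (comul x))) =
  slicer (fun y => tfun f g (comul y)) (comul x).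
Proof.
by rewrite -slicer_tmapl slicer_tfun comulA slicer_tmapr.
Qed.

Lemma tensor_mulDl (s t u : tensor G G) : (s + t) * u = s * u + t * u.
Proof. exact: mulrDl. Qed.

Lemma tensor_mulDr (s t u : tensor G G) : s * (t + u) = s * t + s * u.
Proof. exact: mulrDr. Qed.

End HopfAlgebra.

Section Galois.
Variables (R : rcfType) (G : finQuantumGroupType R).
Implicit Types (x y : G) (t : tensor G G).

Let mS t : G := tlift (fun a b => a * antipode b) t.
Let Sm t : G := tlift (fun a b => antipode a * b) t.

Let mS_bilin : bilin (fun a b : G => a * antipode b).
Proof.
split=> [y|y] c u v; first by rewrite mulrDl scalerAl.
by rewrite linearP mulrDr scalerAr.
Qed.

Let Sm_bilin : bilin (fun a b : G => antipode a * b).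
Proof.
split=> [y|y] c u v; last by rewrite mulrDr scalerAr.
by rewrite linearP mulrDl scalerAl.
Qed.

HB.instance Definition _ := GRing.isLinear.Build R[i] (tensor G G) G _ mS
  (tlift_is_linear _).
HB.instance Definition _ := GRing.isLinear.Build R[i] (tensor G G) G _ Sm
  (tlift_is_linear _).

(** With Sweedler's notation, the map a (x) b |-> a_1 (x) a_2 b and its inverse
    a (x) b |-> a_1 (x) S(a_2) b. *)
Definition galois t : tensor G G := tlift (fun a b => comul a * (1 ⊗ b)) t.
Definition galois_inv t : tensor G G :=
  tlift (fun a b => tmap idfun antipode (comul a) * (1 ⊗ b)) t.

Lemma galois_is_linear : linear galois.
Proof. exact: tlift_is_linear. Qed.
Lemma galois_inv_is_linear : linear galois_inv.
Proof. exact: tlift_is_linear. Qed.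
HB.instance Definition _ := GRing.isLinear.Build R[i] (tensor G G) (tensor G G)
  _ galois galois_is_linear.
HB.instance Definition _ := GRing.isLinear.Build R[i] (tensor G G) (tensor G G)
  _ galois_inv galois_inv_is_linear.

Let bilin_mul (F : {linear G -> tensor G G}) :
  bilin (fun a b : G => F a * (1 ⊗ b)).
Proof.
split=> [y|y] c u v; first by rewrite linearP mulrDl scalerAl.
by rewrite tensDr tensZr mulrDr scalerAr.
Qed.

Lemma galoisE a b : galois (a ⊗ b) = comul a * (1 ⊗ b).
Proof. by rewrite /galois tliftE //; apply: bilin_mul. Qed.

Lemma galois_invE a b :
  galois_inv (a ⊗ b) = tmap idfun antipode (comul a) * (1 ⊗ b).
Proof.
rewrite /galois_inv tliftE //; apply: (bilin_mul (tmap idfun antipode \o comul)).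
Qed.

Lemma galoisMr t b : galois (t * (1 ⊗ b)) = galois t * (1 ⊗ b).
Proof.
elim/tens_ind: t => [u v|s t hs ht].
  by rewrite tensM mulr1 !galoisE -mulrA tensM mulr1.
by rewrite tensor_mulDl !linearD /= hs ht tensor_mulDl.
Qed.

Lemma galois_invMr t b : galois_inv (t * (1 ⊗ b)) = galois_inv t * (1 ⊗ b).
Proof.
elim/tens_ind: t => [u v|s t hs ht].
  by rewrite tensM mulr1 !galois_invE -mulrA tensM mulr1.
by rewrite tensor_mulDl !linearD /= hs ht tensor_mulDl.
Qed.

(** a_1 (x) a_2 S(a_3) = a (x) 1: after reassociation the last two legs are
    contracted by the antipode axiom. *)
Lemma galois_antipode x : galois (tmap idfun antipode (comul x)) = x ⊗ 1.
Proof.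
have shift t : galois (tmap idfun antipode t) =
    tmap idfun mS (tassoc (tmap comul idfun t)).
  elim/tens_ind: t => [c d|s t hs ht]; last by rewrite !linearD /= hs ht.
  rewrite !tmapE /= galoisE; elim/tens_ind: (comul c) => [p q|s t hs ht].
    by rewrite tensM mulr1 tassocE tmapE /= /mS tliftE.
  by rewrite tensor_mulDl tensDl !linearD /= hs ht.
rewrite shift comulA -[x in RHS]slicer_eps.
elim/tens_ind: (comul x) => [u v|s t hs ht].
  rewrite !tmapE /= /mS antipoder slicerE tensZl -tensZr //.
by rewrite !linearD /= hs ht tensDl.
Qed.

(** a_1 (x) S(a_2) a_3 = a (x) 1, by the other antipode axiom. *)
Lemma galois_inv_comul x : galois_inv (comul x) = x ⊗ 1.
Proof.
have shift t : galois_inv t = tmap idfun Sm (tassoc (tmap comul idfun t)).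
  elim/tens_ind: t => [c d|s t hs ht]; last by rewrite !linearD /= hs ht.
  rewrite !tmapE /= galois_invE; elim/tens_ind: (comul c) => [p q|s t hs ht].
    by rewrite tmapE tensM mulr1 tassocE tmapE /= /Sm tliftE.
  by rewrite linearD /= tensor_mulDl tensDl !linearD /= hs ht.
rewrite shift comulA -[x in RHS]slicer_eps.
elim/tens_ind: (comul x) => [u v|s t hs ht].
  by rewrite !tmapE /= /Sm antipodel slicerE tensZl -tensZr.
by rewrite !linearD /= hs ht tensDl.
Qed.

Lemma galois_invK : cancel galois_inv galois.
Proof.
elim/tens_ind => [a b|s t hs ht]; last by rewrite !linearD /= hs ht.
by rewrite galois_invE galoisMr galois_antipode tensM mulr1 mul1r.
Qed.

Lemma galoisK : cancel galois galois_inv.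
Proof.
elim/tens_ind => [a b|s t hs ht]; last by rewrite !linearD /= hs ht.
by rewrite galoisE galois_invMr galois_inv_comul tensM mulr1 mul1r.
Qed.

Lemma comul_galois x t : comul x * galois t = galois ((x ⊗ 1) * t).
Proof.
elim/tens_ind: t => [a b|s t hs ht].
  by rewrite tensM mul1r !galoisE rmorphM mulrA.
by rewrite linearD /= !tensor_mulDr hs ht linearD.
Qed.

(** Left multiplication by Delta(x) is conjugate, through the Galois map, to left
    multiplication by x (x) 1. The traces of the two are the two sides. *)
Lemma ltrace_conv x :
  tfun (@ltrace _ G) (@ltrace _ G) (comul x) = (dim G)%:R * ltrace x.
Proof.
have lin (u : tensor G G) : linear (fun s => u * s).
  by move=> c s t; rewrite mulrDr scalerAr.
pose L u : {linear tensor G G -> tensor G G} :=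
  HB.pack (fun s => u * s) (GRing.isLinear.Build _ _ _ _ _ (lin u)).
pose LW : {linear tensor G G -> tensor G G} :=
  HB.pack (fun s => (x ⊗ 1) * galois_inv s)
   (GRing.isLinear.Build _ _ _ _ _ (fun c s t => etrans (congr1 _ (linearP galois_inv c s t)) (lin _ _ _ _))).
rewrite -ttrace_mul.
have -> : (fun s => comul x * s) = (fun s => galois (LW s)).
  by apply/funext => s /=; rewrite -comul_galois galois_invK.
rewrite ttraceC.
have -> : (fun s => LW (galois s)) = (fun s => (x ⊗ 1) * s).
  by apply/funext => s /=; rewrite galoisK.
by rewrite ttrace_mul tfunE /= ltrace1 mulrC.
Qed.

End Galois.

(** * The Haar state *)
Section Haar.
Variables (R : rcfType) (G : finQuantumGroupType R).
Implicit Types (x y : G) (t : tensor G G) (f g : {scalar G}).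

Lemma slicel_mull f t y : slicel f ((1 ⊗ y) * t) = y * slicel f t.
Proof.
elim/tens_ind: t => [a b|s t hs ht].
  by rewrite tensM mul1r !slicelE scalerAr.
by rewrite tensor_mulDr !linearD /= hs ht mulrDr.
Qed.

Lemma slicel_mulr f t y : slicel f (t * (1 ⊗ y)) = slicel f t * y.
Proof.
elim/tens_ind: t => [a b|s t hs ht].
  by rewrite tensM mulr1 !slicelE scalerAl.
by rewrite tensor_mulDl !linearD /= hs ht mulrDl.
Qed.

Lemma slicer_mull f t y : slicer f ((y ⊗ 1) * t) = y * slicer f t.
Proof.
elim/tens_ind: t => [a b|s t hs ht].
  by rewrite tensM mul1r !slicerE scalerAr.
by rewrite tensor_mulDr !linearD /= hs ht mulrDr.
Qed.

Lemma slicer_mulr f t y : slicer f (t * (y ⊗ 1)) = slicer f t * y.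
Proof.
elim/tens_ind: t => [a b|s t hs ht].
  by rewrite tensM mulr1 !slicerE scalerAl.
by rewrite tensor_mulDl !linearD /= hs ht mulrDl.
Qed.

Lemma slicel_star f t : positive f -> slicel f (star t) = star (slicel f t).
Proof.
move=> fp; elim/tens_ind: t => [a b|s t hs ht].
  by rewrite star_tens !slicelE starZ positive_star.
by rewrite starD !linearD /= hs ht starD.
Qed.

Lemma slicer_star f t : positive f -> slicer f (star t) = star (slicer f t).
Proof.
move=> fp; elim/tens_ind: t => [a b|s t hs ht].
  by rewrite star_tens !slicerE starZ positive_star.
by rewrite starD !linearD /= hs ht starD.
Qed.

(** As l Y is the orthogonal projection of X onto Y, the squared distance is the
    difference of the squared norms. *)
Lemma sqr_defect (B : starAlgType R) (w : {scalar B}) (c l : R[i]) (X Y : B) :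
  w (star X * X) = c -> w (star Y * Y) = c ->
  w (star Y * X) = l * c -> w (star X * Y) = Num.conj l * c ->
  w (star (X + (- l) *: Y) * (X + (- l) *: Y)) = (1 - l * Num.conj l) * c.
Proof.
move=> XX YY YX XY; rewrite sqr_addZ XX YY YX XY rmorphN /=; ring.
Qed.

(** How far Delta(x) is from c 1 (x) x in the seminorm of f (x) g, when x is an
    eigenvector, for the eigenvalue c, of the operator (f (x) id) Delta and g is
    invariant under that operator. The right-hand side being at least 0 bounds c,
    and its vanishing for |c| = 1 drives the peripheral analysis. *)
Lemma eigen_defect f g x c (D := comul x + (- c) *: (1 ⊗ x)) :
  positive f -> f 1 = 1 -> (forall y, g (slicel f (comul y)) = g y) ->
  slicel f (comul x) = c *: x ->
  tfun f g (star D * D) = (1 - c * Num.conj c) * g (star x * x).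
Proof.
move=> fp f1 inv Tx; apply: (@sqr_defect _ (tfun f g)).
- by rewrite -comul_star -rmorphM /= tfun_slicel inv.
- by rewrite star_tens star1 tensM mul1r /= tfunE f1 mul1r.
- by rewrite star_tens star1 /= tfun_slicel slicel_mull Tx -scalerAr linearZ.
- rewrite -comul_star /= tfun_slicel slicel_mulr comul_star slicel_star // Tx.
  by rewrite starZ -scalerAl linearZ.
Qed.

(** The normalised regular trace; its invariance on both sides is what makes it
    the Haar state. *)
Definition haar x : R[i] := ltrace x / (dim G)%:R.

Lemma haar_is_scalar : scalar haar.
Proof. by move=> c x y; rewrite /haar linearP mulrDl mulrA. Qed.

HB.instance Definition _ := GRing.isLinear.Build R[i] G R[i] *%R haar haar_is_scalar.

Lemma haarB x y : haar (x - y) = haar x - haar y.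
Proof. exact: linearB. Qed.

Lemma haarZ c x : haar (c *: x) = c * haar x.
Proof. exact: linearZ. Qed.

Let dimG_gt0 : 0 < (dim G)%:R :> R[i].
Proof. by rewrite ltr0n dim_gt0. Qed.

Lemma haar1 : haar 1 = 1.
Proof. by rewrite /haar ltrace1 divff // lt0r_neq0. Qed.

Lemma haar_positive : positive haar.
Proof.
move=> x; have [? _] := ltrace_star_mul x.
by rewrite /= /haar divr_ge0 // ltW.
Qed.

Lemma haar_faithful : faithful haar.
Proof.
move=> x /= /eqP; have [_ h] := ltrace_star_mul x.
by rewrite /haar mulf_eq0 invr_eq0 (negPf (lt0r_neq0 dimG_gt0)) orbF => /eqP /h.
Qed.

Lemma haar_idem x : tfun haar haar (comul x) = haar x.
Proof.
have E t : tfun haar haar t =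
    tfun (@ltrace _ G) (@ltrace _ G) t / (dim G)%:R / (dim G)%:R.
  elim/tens_ind: t => [a b|s t hs ht].
    by rewrite !tfunE /= /haar; ring.
  by rewrite !tfunD hs ht -!mulrDl.
by rewrite E ltrace_conv /haar [_ * ltrace x]mulrC mulfK // lt0r_neq0.
Qed.

(** As h is idempotent for the convolution, y = (h (x) id) Delta(x) is a fixed
    point of (h (x) id) Delta. Its defect vanishes, and h (x) h is faithful, so
    Delta(y) = 1 (x) y; applying id (x) eps shows that y is scalar. *)
Lemma haar_invl x : slicel haar (comul x) = haar x *: 1.
Proof.
set y := slicel haar (comul x).
have Ty : slicel haar (comul y) = 1 *: y.
  rewrite scale1r slicel_conv /y; congr (slicel _ _).
  by apply/funext => z; rewrite haar_idem.
have inv z : haar (slicel haar (comul z)) = haar z by rewrite -tfun_slicel haar_idem.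
have := eigen_defect haar_positive haar1 inv Ty.
rewrite rmorph1 mulr1 subrr mul0r => /(tfun_faithful haar_positive
  haar_positive haar_faithful haar_faithful).
rewrite scaleN1r => /eqP; rewrite subr_eq0 => /eqP comul_y.
rewrite -[LHS]slicer_eps comul_y slicerE; congr (_ *: _).
by rewrite /y -tfun_slicel tfun_slicer slicer_eps.
Qed.

(** The mirror image of haar_invl, with y (x) 1 in place of 1 (x) y. *)
Lemma haar_invr x : slicer haar (comul x) = haar x *: 1.
Proof.
set y := slicer haar (comul x).
have Ry : slicer haar (comul y) = y.
  rewrite slicer_conv /y; congr (slicer _ _).
  by apply/funext => z; rewrite haar_idem.
pose D := comul y + (- 1) *: (y ⊗ 1).
have : tfun haar haar (star D * D) = (1 - 1 * Num.conj 1) * haar (star y * y).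
  apply: (@sqr_defect _ (tfun haar haar)); rewrite ?rmorph1 ?mul1r.
  - by rewrite -comul_star -rmorphM /= haar_idem.
  - by rewrite star_tens star1 tensM mul1r /= tfunE /= haar1 mulr1.
  - by rewrite star_tens star1 /= tfun_slicer slicer_mull Ry.
  - rewrite -comul_star /= tfun_slicer slicer_mulr comul_star slicer_star ?Ry //.
    exact: haar_positive.
rewrite rmorph1 mulr1 subrr mul0r => /(tfun_faithful haar_positive
  haar_positive haar_faithful haar_faithful).
rewrite /D scaleN1r => /eqP; rewrite subr_eq0 => /eqP comul_y.
rewrite -[LHS]slicel_eps comul_y slicelE; congr (_ *: _).
by rewrite /y -tfun_slicer tfun_slicel slicel_eps.
Qed.

End Haar.

(** * The stochastic operator and its peripheral eigenvectors *)
Section Riesz.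
Variables (R : rcfType) (A : starAlgType R) (w : {scalar A}).
Hypothesis wfaith : faithful w.

(** The Gram matrix of a basis of V is invertible, because a vector of its kernel
    gives an element of V of norm 0. *)
Lemma riesz (V : {vspace A}) (f : {scalar A}) :
  exists2 q, q \in V & {in V, forall x, w (star q * x) = f x}.
Proof.
pose e i := (vbasis V)`_i; pose n := \dim V.
have eV (i : 'I_n) : e i \in V by apply/vbasis_mem/mem_nth; rewrite size_tuple.
pose M : 'M[R[i]]_n := \matrix_(i, j) w (star (e i) * e j).
(* The product is antilinear on the left, hence the conjugate coordinates. *)
pose vec (v : 'rV[R[i]]_n) : A := \sum_i Num.conj (v 0 i) *: e i.
have vecV v : vec v \in V.
  by apply: rpred_sum => i _; apply: rpredZ; apply: eV.
have vecE v (j : 'I_n) : w (star (vec v) * e j) = (v *m M) 0 j.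
  rewrite /vec (star_sum (fun i => Num.conj (v 0 i))) mulr_suml linear_sum mxE.
  apply: eq_bigr => i _ /=.
  by rewrite conjCK -scalerAl linearZ /= mxE.
have vecP v x : x \in V -> (forall j : 'I_n, w (star (vec v) * e j) = f (e j)) ->
    w (star (vec v) * x) = f x.
  move=> xV h; rewrite (coord_vbasis xV) mulr_sumr !linear_sum /=.
  by apply: eq_bigr => j _; rewrite -scalerAr !linearZ /= h.
have Mu : M \in unitmx.
  rewrite -row_free_unit; apply: inj_row_free => v vM.
  have v0 : vec v = 0.
    apply: wfaith; rewrite {2}(coord_vbasis (vecV v)) mulr_sumr linear_sum big1 //.
    move=> j _; rewrite -scalerAr linearZ /=.
    by rewrite -[_`_j]/(e j) vecE vM mxE mulr0.
  apply/rowP => i; rewrite mxE.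
  have /freeP/(_ (fun i => Num.conj (v 0 i)) v0 i) := basis_free (vbasisP V).
  by move=> h; apply: (can_inj conjCK); rewrite h rmorph0.
pose k : 'rV[R[i]]_n := (\row_j f (e j)) *m invmx M.
exists (vec k) => // x xV; apply: vecP => // j.
by rewrite vecE /k mulmxKV // mxE.
Qed.

End Riesz.

Section Markov.
Variables (R : realType) (G : finQuantumGroupType R) (nu : {scalar G}).
Hypotheses (nupos : positive nu) (nu1 : nu 1 = 1).
Implicit Types (x y : G).

Definition markov x : G := slicel nu (comul x).

Lemma markov_is_linear : linear markov.
Proof. by move=> c x y; rewrite /markov !linearP. Qed.

HB.instance Definition _ := GRing.isLinear.Build R[i] G G _ markov markov_is_linear.

Lemma comul1 : comul 1 = 1 ⊗ 1 :> tensor G G.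
Proof. by rewrite rmorph1. Qed.

Lemma markov1 : markov 1 = 1.
Proof. by rewrite /markov comul1 slicelE nu1 scale1r. Qed.

Lemma haar_markov x : haar (markov x) = haar x.
Proof. by rewrite /markov -tfun_slicel tfun_slicer haar_invr linearZ /= nu1 mulr1. Qed.

Lemma markov_star x : markov (star x) = star (markov x).
Proof. by rewrite /markov comul_star slicel_star. Qed.

Lemma eps_markov x : eps (markov x) = nu x.
Proof. by rewrite /markov -tfun_slicel tfun_slicer slicer_eps. Qed.

(** Every eigenspace of T is thus invariant under the right slices. *)
Lemma markov_slicer (g : {scalar G}) x :
  markov (slicer g (comul x)) = slicer g (comul (markov x)).
Proof. exact: comul_slice. Qed.

Lemma haar_gt0 x : x != 0 -> 0 < haar (star x * x).
Proof.
move=> x0; rewrite lt_def haar_positive andbT.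
by apply: contra_neq x0; apply: haar_faithful.
Qed.

Lemma eigenvalue_le1 x c : x != 0 -> markov x = c *: x -> c * Num.conj c <= 1.
Proof.
move=> x0 Tx; have := eigen_defect nupos nu1 haar_markov Tx.
move=> E; rewrite -subr_ge0 -(pmulr_lge0 _ (haar_gt0 x0)) -E.
exact: tfun_positive nupos (@haar_positive _ G) (@haar_faithful _ G) _.
Qed.

(** Eigenvectors of modulus one lie in the multiplicative domain of T: the defect
    of y is a null vector of nu (x) h, so multiplying it on the left by
    (1 (x) d^* ) Delta(x) gives a tensor on which nu (x) h vanishes. Since d is
    arbitrary and h faithful, the identity follows. *)
Lemma markovM x y c : markov y = c *: y -> c * Num.conj c = 1 ->
  markov (x * y) = c *: (markov x * y).
Proof.
move=> Ty c1; apply/eqP; rewrite -subr_eq0; apply/eqP.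
set d := _ - _; apply: haar_faithful; rewrite /= {2}/d.
have D0 := eigen_defect nupos nu1 haar_markov Ty.
rewrite c1 subrr mul0r in D0.
have null z := positive_null z
  (tfun_positive nupos (@haar_positive _ G) (@haar_faithful _ G)) D0.
have sum_null (B : starAlgType R) (w : {scalar B}) (a b u v : B) k :
    w (a * b * (u + (- k) *: v)) = 0 -> w (a * (b * u)) = k * w (a * (b * v)).
  rewrite mulrDr -!mulrA -!scalerAr linearD linearZ /= mulNr => /eqP.
  by rewrite subr_eq0 => /eqP.
have := sum_null (tensor G G) (tfun nu (@haar R G)) _ _ _ _ _ (null (1 ⊗ star d * comul x)).
rewrite -rmorphM /= !tfun_slicel !slicel_mull slicel_mulr /= => E.
by rewrite mulrBr -scalerAr haarB haarZ -E subrr.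
Qed.

Let fixed_lin : linear (fun x => markov x - x).
Proof. by move=> c x y; rewrite linearP scalerBr opprD addrACA. Qed.

Let fixed : {vspace G} := lker (linfun (HB.pack (fun x => markov x - x)
  (GRing.isLinear.Build R[i] G G _ _ fixed_lin) : {linear G -> G})).

Let fixedP x : reflect (markov x = x) (x \in fixed).
Proof.
rewrite memv_ker lfunE /= subr_eq0; exact: eqP.
Qed.

Let fixedM x y : markov x = x -> markov y = y -> markov (x * y) = x * y.
Proof.
move=> hx hy; have := @markovM x y 1; rewrite rmorph1 mulr1 !scale1r hx.
by apply.
Qed.

Let fixed_star x : markov x = x -> markov (star x) = star x.
Proof. by move=> hx; rewrite markov_star hx. Qed.

(** The fixed points of T form a star-algebra on which eps is a character. Let q
    be the fixed point that represents eps for the inner product of h. It is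
    orthogonal to the kernel of eps among the fixed points; for x fixed,
    z = x q - eps(x) q lies in that kernel, and so does x^* z, whence
    h(z^* z) = 0. Then p is q divided by eps(q) = h(q^* q). *)
Lemma fixed_support : exists p : G, [/\ projection p, eps p = 1, markov p = p &
  forall x, markov x = x -> x * p = eps x *: p].
Proof. 
have [q /fixedP qV qE] := riesz (@haar_faithful _ G) fixed [the {scalar G} of @eps R G].
have {}qE x : markov x = x -> haar (star q * x) = eps x by move=> /fixedP/qE.
have eq1 : eps q = haar (star q * q) by rewrite qE.
have q0 : q != 0.
  apply: contraNneq (oner_neq0 R[i]) => q0.
  have <- : eps (1 : G) = 1 by rewrite eps1.
  by rewrite -qE ?markov1 // q0 star0 mul0r linear0.
have c0 : eps q != 0 by rewrite eq1 lt0r_neq0 // haar_gt0.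
have qabs x : markov x = x -> x * q = eps x *: q.
  move=> hx; pose z := x * q - eps x *: q.
  suff z0 : z = 0 by apply/eqP; rewrite -subr_eq0; apply/eqP.
  have fz : markov z = z by rewrite linearB linearZ /= qV fixedM.
  have ez : eps z = 0 by rewrite linearB linearZ /= epsM subrr.
  have orth u : markov u = u -> eps u = 0 -> haar (star u * q) = 0.
    move=> fu eu; rewrite (positive_conj _ _ (@haar_positive _ G)).
    by rewrite /= qE // eu rmorph0.
  apply: haar_faithful; rewrite /= {2}/z mulrBr haarB -scalerAr haarZ.
  rewrite (orth z) // mulr0 subr0 mulrA -[star z * x]starK starM starK.
  by rewrite orth ?fixedM ?fixed_star ?epsM ?ez ?mulr0.
pose p := (eps q)^-1 *: q.
have pE : eps p = 1 by rewrite linearZ /= mulVf.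
have pfix : markov p = p by rewrite linearZ /= qV.
have pabs x : markov x = x -> x * p = eps x *: p.
  by move=> hx; rewrite /p -scalerAr qabs // !scalerA mulrC.
have ssp : star p * p = p.
  by rewrite pabs ?fixed_star // eps_star pE rmorph1 scale1r.
have sp : star p = p by rewrite -ssp starM starK.
by exists p; split => //; split => //; rewrite -{1}sp.
Qed.

End Markov.

(** * A fixed point that is not scalar gives a quasi-subgroup *)
Section QuasiSubgroups.
Variables (R : realType) (G : finQuantumGroupType R).
Implicit Types (x y p : G).

(** Put Z = Delta(p)(1 (x) p) and Y = p (x) p. The hypothesis gives Y^* Z = Y, and
    invariance gives (h (x) h)(Z^* Z) = h(p)^2 = (h (x) h)(Y^* Y), so Z - Y has
    norm 0 for the faithful h (x) h. *)
Lemma left_group_like_flip p : projection p ->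
  (p ⊗ 1) * comul p = p ⊗ p -> comul p * (1 ⊗ p) = p ⊗ p.
Proof.
move=> [sp pp] left.
pose Z := comul p * (1 ⊗ p).
have sYZ : star (p ⊗ p) * Z = p ⊗ p.
  have -> : star (p ⊗ p) = (1 ⊗ p) * (p ⊗ 1) :> tensor G G.
    by rewrite star_tens sp tensM mul1r mulr1.
  by rewrite /Z -mulrA (mulrA (p ⊗ 1)) left !tensM !mul1r mulr1 !pp.
have w_pp : tfun (@haar R G) (@haar R G) (p ⊗ p) = haar p * haar p by rewrite tfunE.
have hp : Num.conj (haar p) = haar p.
  by rewrite -{2}sp (positive_star p (@haar_positive _ G)).
have : tfun (@haar R G) (@haar R G) (star (Z + (- 1) *: (p ⊗ p)) * (Z + (- 1) *: (p ⊗ p))) =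
    (1 - 1 * Num.conj 1) * (haar p * haar p).
  apply: (@sqr_defect _ _ (tfun (@haar R G) (@haar R G))); rewrite /= ?rmorph1 ?mul1r.
  - rewrite /Z starM star_tens star1 sp -comul_star sp -mulrA [X in _ * X]mulrA.
    rewrite -rmorphM /= pp tfun_slicel slicel_mull slicel_mulr haar_invl.
    by rewrite /= -scalerAl -scalerAr mul1r pp haarZ.
  - by rewrite star_tens sp tensM pp w_pp.
  - by rewrite sYZ w_pp.
  - rewrite (positive_conj (w := tfun (@haar R G) (@haar R G))) /=; last first.
      exact: tfun_positive (@haar_positive _ G) (@haar_positive _ G) (@haar_faithful _ G).
    by rewrite sYZ w_pp rmorphM /= hp.
rewrite rmorph1 mulr1 subrr mul0r => /(tfun_faithful (@haar_positive _ G)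
  (@haar_positive _ G) (@haar_faithful _ G) (@haar_faithful _ G)).
by rewrite scaleN1r => /eqP; rewrite subr_eq0 => /eqP.
Qed.


Section FixedPoints.
Variable nu : {scalar G}.
Hypotheses (nupos : positive nu) (nu1 : nu 1 = 1).

(** The projection p of fixed_support works: a right slice z of Delta(p) is a
    fixed point, so p z = eps(z) p, that is (p (x) 1) Delta(p) = p (x) p. *)
Lemma fixed_nonscalar x : markov nu x = x -> x <> eps x *: 1 ->
  supported_on_proper_quasi_subgroup nu.
Proof.
move=> Tx xns; have [p [pproj pe Tp pabs]] := fixed_support nupos nu1.
have [sp pp] := pproj.
exists p; split; last by rewrite -eps_markov Tp.
  split=> //; first by move=> p0; have := oner_neq0 R[i]; rewrite -pe p0 linear0 eqxx.
  apply: left_group_like_flip => //; apply: slicer_inj => g.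
  rewrite slicer_mull slicerE.
  have fz : markov nu (slicer g (comul p)) = slicer g (comul p).
    by rewrite markov_slicer Tp.
  rewrite -[LHS]starK starM sp pabs ?(markov_star nupos) ?fz // starZ sp eps_star conjCK.
  by rewrite -tfun_slicer tfun_slicel slicel_eps.
by move=> p1; apply: xns; have := pabs _ Tx; rewrite p1 mulr1.
Qed.

End FixedPoints.
End QuasiSubgroups.

(** * A periodic eigenvector gives a cyclic coset *)
Section EndomorphismMatrix.
Variables (K : fieldType) (V : vectType K) (f : {linear V -> V}).

Definition opmx : 'M[K]_(dim V) := lin1_mx (v2r \o f \o r2v).

Lemma v2r_op x : v2r (f x) = v2r x *m opmx.
Proof. by rewrite mul_rV_lin1 /= v2rK. Qed.

Lemma eigenvalue_opmx a : reflect (exists2 x, f x = a *: x & x != 0) (eigenvalue opmx a).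
Proof.
apply: (iffP eigenvalueP) => [[v va v0]|[x xa x0]].
  exists (r2v v); first by apply: v2r_inj; rewrite v2r_op linearZ /= r2vK.
  by apply: contra_neq v0 => h; rewrite -(r2vK v) h linear0.
exists (v2r x); first by rewrite -v2r_op xa linearZ.
by apply: contra_neq x0 => h; apply: v2r_inj; rewrite h linear0.
Qed.

End EndomorphismMatrix.

Section FiniteOrder.
Variable K : fieldType.

(** A matrix has finitely many eigenvalues, so two powers of c coincide. *)
Lemma expr_eigenvalue_order n (M : 'M[K]_n) (c : K) : c != 0 ->
  (forall k, eigenvalue M (c ^+ k)) -> exists2 d, (0 < d)%N & c ^+ d = 1.
Proof.
move=> c0 eig.
pose s := mkseq (fun k => c ^+ k) n.+1.
have : ~~ uniq s.
  apply/negP => us; have cp0 : char_poly M != 0 by apply: monic_neq0; exact: char_poly_monic.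
  have rs : all (root (char_poly M)) s.
    by apply/allP => z /mapP[k _ ->]; rewrite -eigenvalue_root_char.
  by have := max_poly_roots cp0 rs us; rewrite size_mkseq size_char_poly ltnn.
case/(uniqPn 0) => i [j [ij]]; rewrite size_mkseq => jn.
rewrite !nth_mkseq // ?(ltn_trans ij) // => cij.
exists (j - i)%N; first by rewrite subn_gt0.
apply: (mulfI (expf_neq0 i c0)); rewrite -exprD subnKC ?(ltnW ij) //.
by rewrite mulr1.
Qed.

End FiniteOrder.

Section CyclicAverage.
Variables (R : realType) (G : finQuantumGroupType R).
Implicit Types (u w p : G).

(** When w^d = 1, the spectral projection of w for the eigenvalue 1. *)
Definition cyclic_avg d w : G := d%:R^-1 *: \sum_(k < d) w ^+ k.

Lemma star_bigsum (I : Type) (s : seq I) (F : I -> G) :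
  star (\sum_(i <- s) F i) = \sum_(i <- s) star (F i).
Proof. exact: (big_morph _ (@starD _ G) (@star0 _ G)). Qed.

Lemma cyclic_avg_fix d w : w ^+ d = 1 -> w * cyclic_avg d w = cyclic_avg d w.
Proof.
rewrite /cyclic_avg; case: d => [|d] wd; first by rewrite !big_ord0 scaler0 mulr0.
rewrite -scalerAr mulr_sumr big_ord_recr /= -exprS wd big_ord_recl /= expr0 addrC.
by congr (_ *: (_ + _)); apply: eq_bigr => k _; rewrite -exprS.
Qed.

Lemma cyclic_avg_proj d w : (0 < d)%N -> star w * w = 1 -> w ^+ d = 1 ->
  projection (cyclic_avg d w).
Proof.
move=> d0 sw wd; set p := cyclic_avg d w.
have swp : star w * p = p by rewrite -{1}[p](cyclic_avg_fix wd) mulrA sw mul1r.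
have swXp k : star w ^+ k * p = p.
  by elim: k => [|k ih]; rewrite ?expr0 ?mul1r // exprSr -mulrA swp.
have dn0 : d%:R != 0 :> R[i] by rewrite pnatr_eq0 -lt0n.
have ssp : star p * p = p.
  rewrite {1}/p /cyclic_avg starZ star_bigsum -scalerAl mulr_suml.
  under eq_bigr do rewrite starX swXp.
  rewrite sumr_const card_ord -(scaler_nat d p) scalerA.
  by rewrite fmorphV rmorph_nat mulVf // scale1r.
have sp : star p = p by rewrite -ssp starM starK.
by split=> //; rewrite -{1}sp.
Qed.

Lemma eps_cyclic_avg d w : (0 < d)%N -> eps w = 1 -> eps (cyclic_avg d w) = 1.
Proof.
move=> d0 w1; have epsX k : eps (w ^+ k) = 1.
  by elim: k => [|k ih]; rewrite ?expr0 ?eps1 // exprS epsM ih w1 mulr1.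
rewrite linearZ linear_sum /=; under eq_bigr do rewrite epsX.
by rewrite sumr_const card_ord mulVf // pnatr_eq0 -lt0n.
Qed.

Lemma tensX (u v : G) k : (u ⊗ v) ^+ k = (u ^+ k) ⊗ (v ^+ k) :> tensor G G.
Proof.
elim: k => [|k ih]; first by rewrite !expr0.
by rewrite exprS ih tensM -!exprS.
Qed.

Lemma cyclic_avg_group_like d u : (0 < d)%N -> star u * u = 1 -> u ^+ d = 1 ->
  eps u = 1 -> comul u = u ⊗ u -> group_like_projection (cyclic_avg d u).
Proof.
move=> d0 su ud u1 cu; set p := cyclic_avg d u.
have pp := cyclic_avg_proj d0 su ud.
split=> //.
  by move=> p0; have := oner_neq0 R[i]; rewrite -(eps_cyclic_avg d0 u1) -/p p0 linear0 eqxx.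
have up : u * p = p := cyclic_avg_fix ud.
have uXp k : u ^+ k * p = p.
  by elim: k => [|k ih]; rewrite ?expr0 ?mul1r // exprSr -mulrA up.
apply: slicer_inj => g.
have step k : slicer g (comul (u ^+ k) * (1 ⊗ p)) = g p *: u ^+ k.
  by rewrite rmorphXn /= cu tensX tensM mulr1 uXp slicerE.
have lin : linear (fun x => slicer g (comul x * (1 ⊗ p))).
  by move=> c x y; rewrite linearP mulrDl -scalerAl linearP.
pose F : {linear G -> G} := HB.pack (fun x => slicer g (comul x * (1 ⊗ p)))
  (GRing.isLinear.Build _ _ _ _ _ lin).
rewrite slicerE -[LHS]/(F p) {1}/p /cyclic_avg linearZ linear_sum /=.
under eq_bigr do rewrite step.
by rewrite -scaler_sumr !scalerA mulrC.
Qed.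

End CyclicAverage.

Section PeriodicCase.
Variables (R : realType) (G : finQuantumGroupType R) (nu : {scalar G}).
Hypotheses (nupos : positive nu) (nu1 : nu 1 = 1).
Hypothesis fixed_scalar : forall x, markov nu x = x -> x = eps x *: 1.
Implicit Types (x y u : G).

(** If y and z are eigenvectors for c then y^* z is a fixed point, hence scalar.
    So x^* x is scalar, which makes x proportional to a unitary u, normalised by
    eps(u) = 1. A right slice z of Delta(u) is again an eigenvector for c, so
    u^* z is scalar and z is a multiple of u; evaluating eps gives the
    multiple. *)
Lemma unimodular_unitary x c : x != 0 -> markov nu x = c *: x ->
    c * Num.conj c = 1 ->
  exists u, [/\ markov nu u = c *: u, eps u = 1, star u * u = 1 & comul u = u ⊗ u].
Proof.
move=> x0 Tx c1.
have stT y : markov nu y = c *: y -> markov nu (star y) = Num.conj c *: star y.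
  by move=> Ty; rewrite (markov_star nupos) Ty starZ.
have sy_scalar y z : markov nu y = c *: y -> markov nu z = c *: z ->
    star y * z = eps (star y * z) *: 1.
  move=> Ty Tz; apply: fixed_scalar; rewrite (markovM nupos nu1 _ Tz) // stT //.
  by rewrite -scalerAl scalerA c1 scale1r.
have ex0 : eps x != 0.
  apply: contra_neq x0 => ex; apply: star_mul_eq0.
  by rewrite (sy_scalar _ _ Tx Tx) epsM ex mulr0 scale0r.
pose u := (eps x)^-1 *: x.
have eu : eps u = 1 by rewrite linearZ /= mulVf.
have Tu : markov nu u = c *: u by rewrite linearZ /= Tx !scalerA mulrC.
have esu : eps (star u) = 1 by rewrite eps_star eu rmorph1.
have su : star u * u = 1 by rewrite (sy_scalar _ _ Tu Tu) epsM esu eu mulr1 scale1r.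
have us : u * star u = 1.
  rewrite [LHS]fixed_scalar; first by rewrite epsM esu eu mulr1 scale1r.
  rewrite (markovM nupos nu1 _ (stT _ Tu)); last by rewrite conjCK mulrC.
  by rewrite Tu -scalerAl scalerA mulrC c1 scale1r.
exists u; split=> //; apply: slicer_inj => g.
set z := slicer g (comul u); rewrite slicerE.
have Tz : markov nu z = c *: z by rewrite /z markov_slicer Tu linearZ /= linearZ.
have ez : eps z = g u by rewrite -tfun_slicer tfun_slicel slicel_eps.
rewrite -[z]mul1r -us -mulrA (sy_scalar _ _ Tu Tz) epsM esu mul1r ez.
by rewrite -scalerAr mulr1.
Qed.

Lemma markovX u c k : markov nu u = c *: u -> c * Num.conj c = 1 ->
  markov nu (u ^+ k) = c ^+ k *: u ^+ k.
Proof.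
move=> Tu c1; elim: k => [|k ih]; first by rewrite !expr0 scale1r markov1.
by rewrite !exprSr (markovM nupos nu1 _ Tu) // ih -scalerAl scalerA mulrC.
Qed.

(** The powers u^k are eigenvectors for c^k, so c has finite order d, and u^d is a
    fixed point, hence 1. With w = c^-1 u, the averages p_0 of u and p_1 of w are
    spectral projections of u for the eigenvalues 1 and c, hence orthogonal, and T
    multiplies the k-th term of p_1 by c^k, which turns w^k into u^k. *)
Lemma unimodular_nonscalar x c : markov nu x = c *: x -> c * Num.conj c = 1 ->
  x <> eps x *: 1 -> supported_on_cyclic_coset nu.
Proof.
move=> Tx cc xns.
have x0 : x != 0 by apply: contra_notN xns => /eqP ->; rewrite linear0 scale0r.
have c0 : c != 0.
  by apply: contra_eq_neq cc => ->; rewrite mul0r eq_sym oner_neq0.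
have cn1 : c != 1.
  by apply: contra_notN xns => /eqP c1; apply: fixed_scalar; rewrite Tx c1 scale1r.
have [u [Tu eu su cu]] := unimodular_unitary x0 Tx cc.
have Tuk k := markovX k Tu cc.
have euk k : eps (u ^+ k) = 1.
  by elim: k => [|k ih]; rewrite ?expr0 ?eps1 // exprS epsM ih eu mulr1.
have uk0 k : u ^+ k != 0.
  by apply: contra_eq_neq (euk k) => ->; rewrite linear0 eq_sym oner_neq0.
have [N N0 cN] : exists2 d, (0 < d)%N & c ^+ d = 1.
  apply: (@expr_eigenvalue_order _ _ (opmx (markov nu)) c c0) => k.
  by apply/eigenvalue_opmx; exists (u ^+ k) => //; apply: Tuk.
have [d cprim _] := prim_order_exists N0 cN.
have d0 := prim_order_gt0 cprim; have cd := prim_expr_order cprim.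
have d1 : (1 < d)%N.
  rewrite ltn_neqAle d0 andbT; apply: contra_neqN cn1 => /eqP d1.
  by rewrite -[c]expr1 d1.
have ud : u ^+ d = 1.
  by rewrite [LHS]fixed_scalar ?euk ?scale1r // Tuk cd scale1r.
pose w := c^-1 *: u.
have wX k : w ^+ k = c^-1 ^+ k *: u ^+ k by rewrite exprZn.
have wd : w ^+ d = 1 by rewrite wX ud exprVn cd invr1 scale1r.
have sw : star w * w = 1.
  rewrite starZ -scalerAl -scalerAr scalerA su fmorphV -invfM mulrC cc invr1.
  by rewrite scale1r.
pose p0 := cyclic_avg d u; pose p1 := cyclic_avg d w.
have [sp0 pp0] := cyclic_avg_proj d0 su ud.
have [sp1 pp1] := cyclic_avg_proj d0 sw wd.
have up0 : u * p0 = p0 := cyclic_avg_fix ud.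
have up1 : u * p1 = c *: p1.
  rewrite -{2}[p1](cyclic_avg_fix wd : w * p1 = p1) /w -scalerAl scalerA divff //.
  by rewrite scale1r.
have p0u : p0 * u = p0.
  have : star u * p0 = p0 by rewrite -{1}up0 mulrA su mul1r.
  by move/(congr1 (@star R G)); rewrite starM starK sp0.
have p01 : p0 * p1 = 0.
  have : (1 - c) *: (p0 * p1) = 0.
    by rewrite scalerBl scale1r scalerAr -up1 mulrA p0u subrr.
  by move/eqP; rewrite scaler_eq0 subr_eq0 eq_sym (negPf cn1) => /eqP.
have p10 : p1 * p0 = 0.
  by rewrite -[LHS]starK starM sp0 sp1 p01 star0.
have iterT n : iter n (stoch_op nu) p1 =
    d%:R^-1 *: \sum_(k < d) (c^-1 ^+ k * c ^+ (k * n)) *: u ^+ k.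
  elim: n => [|n ih].
    congr (_ *: _); apply: eq_bigr => k _.
    by rewrite wX muln0 expr0 mulr1.
  rewrite iterS ih -[LHS]/(markov nu _) linearZ linear_sum /=.
  congr (_ *: _); apply: eq_bigr => k _.
  by rewrite linearZ /= Tuk scalerA -mulrA -exprD mulnSr.
have Tp1 : stoch_op nu p1 = p0.
  rewrite -[LHS]/(iter 1 (stoch_op nu) p1) iterT.
  congr (_ *: _); apply: eq_bigr => k _.
  by rewrite muln1 exprVn mulVf ?scale1r // expf_neq0.
exists p0, p1; split=> //.
- split=> //; exists (1 - (p0 + p1)).
  have qq : (p0 + p1) * (p0 + p1) = p0 + p1.
    by rewrite mulrDl !mulrDr pp0 pp1 p01 p10 addr0 add0r.
  rewrite starB star1 starD sp0 sp1 mulrBl mul1r mulrBr mulr1 qq subrr subr0 //.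
- by rewrite -eps_markov -[markov nu p1]/(stoch_op nu p1) Tp1 eps_cyclic_avg.
- exact: cyclic_avg_group_like.
split=> //; exists d => //; rewrite iterT.
congr (_ *: _); apply: eq_bigr => k _.
by rewrite mulnC exprM cd expr1n mulr1 wX.
Qed.

End PeriodicCase.

(** * Powers of an operator with eigenvalues in the open disc *)
Section Decay.
Variable R : realType.
Local Notation C := R[i].
Implicit Types (u v : nat -> C).

Definition vanishing u := forall e : R, 0 < e ->
  exists N, forall n, (N <= n)%N -> `|u n| < e%:C.

(** With t = |c| and |v n| <= e (1 - t) / 2 from N on, induction gives
    |u (N + m)| <= t^m |u N| + e / 2. *)
Lemma vanishing_recursion u v (c : C) : c * Num.conj c < 1 -> vanishing v ->
  (forall n, u n.+1 = c * u n + v n) -> vanishing u.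
Proof.
move=> c1 v0 uE e e0.
have [t [t0 t1 ct]] : exists t : R, [/\ 0 <= t, t < 1 & `|c| = t%:C].
  exists (complex.Re `|c|); have cr : `|c| = (complex.Re `|c|)%:C by rewrite RRe_real // normr_real.
  have c_lt1 : `|c| < 1 by rewrite -(@expr_lt1 _ 2) // normCK.
  by split=> //; [rewrite -lecR -cr; exact: normr_ge0|rewrite -ltcR -cr].
have s0 : 0 < e * (1 - t) / 2 by rewrite divr_gt0 // mulr_gt0 // subr_gt0.
have [N vN] := v0 _ s0.
have [b [b0 ub]] : exists b : R, 0 <= b /\ `|u N| = b%:C.
  exists (complex.Re `|u N|); have cr : `|u N| = (complex.Re `|u N|)%:C by rewrite RRe_real // normr_real.
  by split=> //; rewrite -lecR -cr; exact: normr_ge0.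
have bound m : `|u (N + m)%N| <= (t ^+ m * b + e / 2)%:C.
  elim: m => [|m ih].
    rewrite addn0 expr0 mul1r ub lecR lerDl; lra.
  rewrite addnS uE (le_trans (ler_normD _ _)) // normrM ct.
  have h1 : t%:C * `|u (N + m)%N| <= (t * (t ^+ m * b + e / 2))%:C.
    by rewrite rmorphM ler_wpM2l // lecR.
  have h2 : `|v (N + m)%N| <= (e * (1 - t) / 2)%:C by rewrite ltW // vN // leq_addr.
  rewrite (le_trans (lerD h1 h2)) // -rmorphD lecR exprS.
  suff -> : t * (t ^+ m * b + e / 2) + e * (1 - t) / 2 = t * t ^+ m * b + e / 2 by [].
  by field.
have : (t ^+ m * b) @[m --> \oo] --> (0 * b).
  by apply: cvgM; [apply: cvg_expr; rewrite ger0_norm|exact: cvg_cst].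
rewrite mul0r => /cvgrPdist_lt /(_ (e / 2)) [|M _ hM]; first by rewrite divr_gt0.
exists (N + M)%N => n NMn.
have nE : n = (N + (n - N))%N by rewrite subnKC // (leq_trans _ NMn) // leq_addr.
rewrite nE (le_lt_trans (bound _)) // ltcR.
have := hM (n - N)%N; rewrite /= sub0r normrN ger0_norm ?mulr_ge0 ?exprn_ge0 //.
rewrite leq_subRL ?(leq_trans _ NMn) ?leq_addr // => /(_ isT) h.
by lra.
Qed.

(** Cayley-Hamilton, with the characteristic polynomial split into linear
    factors. *)
Lemma annihilating_factors n (M : 'M[C]_n) : exists2 s : seq C,
  {in s, forall c, eigenvalue M c} &
  forall v : 'rV_n, foldl (fun w c => w *m M - c *: w) v s = 0.
Proof.
case: n M => [|n] M; first by exists [::] => // v; apply/rowP; case.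
have [s sE] := closed_field_poly_normal (char_poly M).
rewrite (monicP (char_poly_monic M)) scale1r in sE.
exists s => [c cs|v].
  by rewrite eigenvalue_root_char sE root_prod_XsubC.
suff -> : foldl (fun w c => w *m M - c *: w) v s =
    v *m horner_mx M (\prod_(c <- s) ('X - c%:P)).
  by rewrite -sE Cayley_Hamilton mulmx0.
elim: (s) v => [|c r ih] v; first by rewrite big_nil rmorph1 mulmx1.
rewrite big_cons rmorphM /= ih -[RHS]/(v *m (_ *m _)) mulmxA; congr (_ *m _).
by rewrite rmorphB /= horner_mx_X horner_mx_C mulmxBr mul_mx_scalar.
Qed.

Lemma iter_add (V : zmodType) (f : {additive V -> V}) k x y :
  iter k f (x + y) = iter k f x + iter k f y.
Proof. by elim: k => //= k ->; rewrite raddfD. Qed.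

(** Induction on the factors of a polynomial annihilating x: if y = f x - c x then
    w(f^(k+1) x) = c w(f^k x) + w(f^k y), and the last term tends to 0. *)
Lemma iter_vanishing (V : vectType C) (f : {linear V -> V}) (w : {scalar V}) x :
  (forall c y, y != 0 -> f y = c *: y -> c * Num.conj c < 1) ->
  vanishing (fun k => w (iter k f x)).
Proof.
move=> small; have [s seig skill] := annihilating_factors (opmx f).
have {seig} ssmall : {in s, forall c, c * Num.conj c < 1}.
  by move=> c /seig /eigenvalue_opmx [y fy y0]; apply: small fy.
have {skill} : foldl (fun y c => f y - c *: y) x s = 0.
  apply: v2r_inj; rewrite linear0 -[RHS](skill (v2r x)).
  elim: s x {skill ssmall} => //= c s ih x.
  by rewrite ih linearB linearZ /= v2r_op.
elim: s x ssmall => /= [|c s ih] x ssmall.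
  move=> -> e e0; exists 0%N => n _.
  have -> : iter n f 0 = 0 by elim: n => //= n ->; rewrite linear0.
  by rewrite linear0 normr0 ltcR.
move/ih => {}ih; apply: (@vanishing_recursion _ (fun k => w (iter k f (f x - c *: x))) c).
- by apply: ssmall; rewrite mem_head.
- by apply: ih => d ds; apply: ssmall; rewrite in_cons ds orbT.
move=> n; rewrite iterSr -{1}(subrK (c *: x) (f x)) iter_add linearD addrC.
congr (_ + _); rewrite -linearZ; congr (w _).
by elim: n => //= n ->; rewrite linearZ.
Qed.

End Decay.

(** * The ergodic theorem *)
Section Ergodicity.
Variables (R : realType) (G : finQuantumGroupType R).
Implicit Types (x y p : G).

Lemma haar_haar_state : haar_state (@haar R G).
Proof.
split.
  split; [exact: haar_is_scalar|exact: haar_positive|exact: haar1].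
move=> mu [mus _ mu1].
pose m : {scalar G} := HB.pack mu (GRing.isLinear.Build _ _ _ _ _ mus).
split=> x.
  rewrite -[LHS]/(tfun (@haar R G) m (comul x)) tfun_slicel haar_invl.
  by rewrite linearZ /= mu1 mulr1.
rewrite -[LHS]/(tfun m (@haar R G) (comul x)) tfun_slicer haar_invr.
by rewrite linearZ /= mu1 mulr1.
Qed.

Lemma haar_projection1 p : projection p -> haar p = 1 -> p = 1.
Proof.
move=> [sp pp] hp; apply/eqP; rewrite eq_sym -subr_eq0; apply/eqP.
apply: haar_faithful.
by rewrite /= starB star1 sp mulrBl mul1r mulrBr mulr1 pp subrr subr0 haarB haar1 hp subrr.
Qed.

Variable nu : {scalar G}.
Hypotheses (nupos : positive nu) (nu1 : nu 1 = 1).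

Lemma convpowE k x : convpow nu k.+1 x = nu (iter k (markov nu) x).
Proof.
rewrite /convpow /=; elim: k x => //= k ih x.
have lin : scalar (fun y => nu (iter k (markov nu) y)).
  move=> c y z; rewrite iter_add linearD -linearZ; congr (nu _ + _).
  by elim: (k) => //= n ->; rewrite linearZ.
pose m : {scalar G} := HB.pack (fun y => nu (iter k (markov nu) y))
  (GRing.isLinear.Build _ _ _ _ _ lin).
have -> : iter k (Defs.conv nu) nu = m by apply/funext => y; rewrite ih.
rewrite -[LHS]/(tfun nu m (comul x)) tfun_slicel -[LHS]/(nu (iter k _ (markov nu x))).
by rewrite -iterSr.
Qed.

Lemma ergodic_frequent_value x a : ergodic nu ->
  (forall N, exists2 n, (N <= n)%N & convpow nu n.+1 x = a) -> haar x = a.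
Proof.
move=> [pi hpi cvg] freq.
rewrite (haar_state_unique haar_haar_state hpi x).
apply/eqP; rewrite -subr_eq0 -normr_le0 real_leNgt ?real0 ?normr_real //.
apply/negP => d0.
have /cvgrPdist_lt /(_ _ d0) [N _ hN] := cvg x.
have [n Nn E] := freq N.
by have := hN n.+1 (leqW Nn); rewrite /= E ltxx.
Qed.

Lemma eps_slicer y : eps (slicer nu (comul y)) = nu y.
Proof. by rewrite -tfun_slicer tfun_slicel slicel_eps. Qed.

(** As nu vanishes on the left ideal generated by 1 - p, slicing the group-like
    relation by nu on the right gives (id (x) nu) Delta(p) = p. This operator
    commutes with T, so T^k p is fixed by it and eps(T^(k+1) p) = eps(T^k p). *)
Lemma ergodic_not_quasi_subgroup : ergodic nu ->
  ~ supported_on_proper_quasi_subgroup nu.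
Proof.
move=> erg [p [[[sp pp] p0 gl] pn1 nup]]; apply: pn1.
apply: haar_projection1 => //; apply: ergodic_frequent_value => // N; exists N => //.
have nul y : nu (y * (1 - p)) = 0.
  apply: positive_null nupos _.
  rewrite starB star1 sp mulrBl mul1r mulrBr mulr1 pp subrr subr0.
  by rewrite linearB /= nu1 nup subrr.
have cut y : nu (y * p) = nu y.
  by apply/eqP; rewrite eq_sym -subr_eq0 -linearB -{1}[y]mulr1 -mulrBr nul.
have cutt (t : tensor G G) : slicer nu (t * (1 ⊗ p)) = slicer nu t.
  elim/tens_ind: t => [a b|s t hs ht]; first by rewrite tensM mulr1 !slicerE cut.
  by rewrite tensor_mulDl !linearD /= hs ht.
have Rp : slicer nu (comul p) = p by rewrite -cutt gl slicerE nup scale1r.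
have RTp k : slicer nu (comul (iter k (markov nu) p)) = iter k (markov nu) p.
  by elim: k => //= k ih; rewrite -markov_slicer ih.
rewrite convpowE; elim: N => //= N <-.
by rewrite -eps_slicer (RTp N.+1) eps_markov.
Qed.

(** By periodicity nu^{*k}(p_1) = 1 for k = N d + 1, which forces p_1 = 1, while
    p_0 p_1 = 0 and p_0 is not 0. *)
Lemma ergodic_not_cyclic_coset : ergodic nu -> ~ supported_on_cyclic_coset nu.
Proof.
move=> erg [p0 [p1 [[_ proj1] [p01 _] nup1 [_ p0n0 _] [_ [d d1 Td]]]]].
apply: p0n0; rewrite -p01.
suff -> : p1 = 1 by rewrite mulr1.
apply: haar_projection1 => //; apply: ergodic_frequent_value => // N.
exists (N * d)%N; first by rewrite leq_pmulr // ltnW.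
rewrite convpowE -[RHS]nup1; congr (nu _).
by elim: N => // N ih; rewrite mulSn iterD ih.
Qed.

(** Subtracting the projection h(.)1 onto the scalars removes the eigenvalue 1
    of T and leaves only eigenvalues of modulus less than one. *)
Lemma peripheral_ergodic :
  (forall x c, markov nu x = c *: x -> c * Num.conj c = 1 -> x = eps x *: 1) ->
  ergodic nu.
Proof.
move=> peri; exists (@haar R G); first exact: haar_haar_state.
have lin : linear (fun x => markov nu x - haar x *: 1).
  move=> c x y; rewrite linearP /= (haar_is_scalar c x y) scalerDl opprD addrACA.
  by rewrite scalerBr scalerA.
pose T0 : {linear G -> G} := HB.pack (fun x => markov nu x - haar x *: 1)
  (GRing.isLinear.Build _ _ _ _ _ lin).
have small c y : y != 0 -> T0 y = c *: y -> c * Num.conj c < 1.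
  move=> y0 Ty; have [->|c0] := eqVneq c 0; first by rewrite mul0r ltr01.
  have hy : haar y = 0.
    have : haar (T0 y) = 0.
      by rewrite /= haarB haarZ haar1 mulr1 haar_markov // subrr.
    by rewrite Ty haarZ => /eqP; rewrite mulf_eq0 (negPf c0) => /eqP.
  have {}Ty : markov nu y = c *: y by rewrite -Ty /= hy scale0r subr0.
  rewrite lt_def (eigenvalue_le1 nupos nu1 y0 Ty) andbT eq_sym.
  apply: contra_neq y0 => cc; have yE := peri _ _ Ty cc.
  have ey : eps y = 0 by rewrite -hy yE haarZ haar1 mulr1 linearZ /= eps1 mulr1.
  by rewrite yE ey scale0r.
have iterE k x : iter k.+1 T0 x = iter k.+1 (markov nu) x - haar x *: 1.
  elim: k => //= k ->.
  rewrite linearB linearZ /= markov1 // haarB haarZ haar1 mulr1.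
  have -> : haar (markov nu (iter k (markov nu) x)) = haar x.
    by rewrite haar_markov //; elim: (k) => //= j ih; rewrite haar_markov.
  by rewrite subrr scale0r subr0.
move=> x; apply/cvgrPdist_lt => e e0.
have er : (complex.Re e)%:C = e by rewrite RRe_real // gtr0_real.
have re0 : 0 < complex.Re e by rewrite -ltcR er.
have [N hN] := iter_vanishing [the {scalar G} of @eps R G] x small re0.
exists N.+1 => // -[//|n] /= Nn.
rewrite -normrN opprB -er convpowE -eps_markov.
have := hN n.+1 (leqW Nn); rewrite iterE linearB linearZ /= eps1 mulr1.
by [].
Qed.

End Ergodicity.

Theorem theorem4p6 (R : realType) (G : finQuantumGroupType R)
    (nu : G -> complex R) (hnu : state nu) :
  ergodic nu <->
  ~ supported_on_proper_quasi_subgroup nu /\ ~ supported_on_cyclic_coset nu.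
Proof.
have [nus nupos nu1] := hnu.
pose m : {scalar G} := HB.pack nu (GRing.isLinear.Build _ _ _ _ _ nus).
split=> [erg|[noQS noCC]].
  split; first exact: (@ergodic_not_quasi_subgroup _ _ m).
  exact: (@ergodic_not_cyclic_coset _ _ m).
have fixed_scalar x : markov m x = x -> x = eps x *: 1.
  move=> Tx; apply: contrapT => xns; apply: noQS.
  exact: (@fixed_nonscalar _ _ m nupos nu1 x).
apply: (@peripheral_ergodic _ _ m nupos nu1) => x c Tx cc.
apply: contrapT => xns; apply: noCC.
exact: (@unimodular_nonscalar _ _ m nupos nu1 fixed_scalar x c).
Qed.
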